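(* Let $[a,b]\subset\mathbb{R}$ be a finite interval. There exists a constant $c_2=c_2(a,b)>0$ such that the following holds. Let $X$ be a rearrangement invariant Banach space on $[a,b]$ and let $\varepsilon>0$. Then, for each $P_n\in E(\Lambda_n)$ and $N\ge\left(\frac{c_2}{\log2}+\varepsilon\right)\gamma(\Lambda_n)$, we have $$\|P_n\|_X\asymp\bigg\|\sum_{k=1}^N|P_n(x_k)|\chi_{\Omega_k}\bigg\|_X,$$ where $x_k$ is an arbitrary point in $\Omega_k=\left[a+\frac{(b-a)(k-1)}N,\,a+\frac{(b-a)k}N\right]$, $k=1,\dots,N$.
   Context: $\Lambda_n=\{\lambda_0<\lambda_1<\dots<\lambda_n\}$ is a set of real numbers, $E(\Lambda_n)=\operatorname{span}\{e^{\lambda_0t},e^{\lambda_1t},\dots,e^{\lambda_nt}\}$, and $\gamma(\Lambda_n)=n^2+\sum_{j=0}^n|\lambda_j|$. The interval $[a,b]$ carries Lebesgue measure $\mu$. The Banach space $X$ of functions on $[a,b]$ is a Banach function lattice: 1) $\|f\|_X=0$ iff $f=0$; 2) $\|\lambda f\|_X=|\lambda|\|f\|_X$ for $\lambda\in\mathbb{C}$; 3) $\|f+g\|_X\le\|f\|_X+\|g\|_X$; 4) if $|f|\le|g|$ then $\|f\|_X\le\|g\|_X$ for $f,g\in X$; 5) $\chi_B\in X$ for all $B$ with $\mu(B)<\infty$; moreover $X\subset L_1$ is assumed. $X$ is rearrangement invariant if $\|f\|_X=\|g\|_X$ whenever $\mu_f=\mu_g$, where $\mu_h(y)=\mu(\{x:|h(x)|\ge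 y\})$ is the distribution function of $h$. $A\asymp B$ means two-sided inequalities with positive constants independent of the essential variables (here $n$, $\Lambda_n$, $N$, $P_n$, and the points $x_k$). *)

(* Defs.v *)
From HB Require Import structures.
From mathcomp Require Import all_boot all_order all_algebra.
From mathcomp Require Import complex.
From mathcomp Require Import all_classical all_reals all_analysis.

Set Implicit Arguments.
Unset Strict Implicit.
Unset Printing Implicit Defensive.

Import Order.TTheory GRing.Theory Num.Theory.
Import numFieldNormedType.Exports.

Local Open Scope classical_set_scope.
Local Open Scope complex_scope.
Local Open Scope ring_scope.

(* Functions on [a, b] are total functions R -> R[i] whose values outside
   [a, b] are irrelevant; as usual for function spaces, they are identified
   when they agree almost everywhere on [a, b]. *)

(* Real-valued modulus: the library's `|z| has its values in R[i]. *)
Definition cmod (R : realType) (z : R[i]) : R := ComplexField.Normc.normc z.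

Definition ae_on (R : realType) (a b : R) (Q : R -> Prop) : Prop :=
  {ae @lebesgue_measure R, forall t, t \in `[a, b] -> Q t}.

Definition cmeasurable (R : realType) (a b : R) (f : R -> R[i]) : Prop :=
  measurable_fun `[a, b]%classic (fun t => complex.Re (f t)) /\
  measurable_fun `[a, b]%classic (fun t => complex.Im (f t)).

Definition in_L1 (R : realType) (a b : R) (f : R -> R[i]) : Prop :=
  cmeasurable a b f /\
  (\int[@lebesgue_measure R]_(t in `[a, b]) (cmod (f t))%:E < +oo)%E.

Definition cindic (R : realType) (B : set R) : R -> R[i] :=
  fun t => (\1_B t : R)%:C.

(* The value of [fl_norm] is meaningful only on [fl_carrier].  The ideal
   property (g in X and |f| <= |g| imply f in X) is not assumed; every bounded
   measurable function nevertheless belongs to X, by [fl_indic],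
   [fl_norm_mono], [fl_norm_eq0] and [fl_complete]. *)
Record function_lattice (R : realType) (a b : R) : Type := FunctionLattice {
  fl_carrier : set (R -> R[i]) ;
  fl_norm : (R -> R[i]) -> R ;
  fl_ae : forall f g, fl_carrier f -> cmeasurable a b g ->
    ae_on a b (fun t => f t = g t) -> fl_carrier g ;
  fl_add : forall f g, fl_carrier f -> fl_carrier g ->
    fl_carrier (fun t => f t + g t) ;
  fl_scale : forall (c : R[i]) f, fl_carrier f ->
    fl_carrier (fun t => c * f t) ;
  fl_L1 : forall f, fl_carrier f -> in_L1 a b f ;
  fl_norm_eq0 : forall f, fl_carrier f ->
    (fl_norm f = 0 <-> ae_on a b (fun t => f t = 0)) ;
  fl_normZ : forall (c : R[i]) f, fl_carrier f ->
    fl_norm (fun t => c * f t) = cmod c * fl_norm f ;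
  fl_normD : forall f g, fl_carrier f -> fl_carrier g ->
    fl_norm (fun t => f t + g t) <= fl_norm f + fl_norm g ;
  fl_norm_mono : forall f g, fl_carrier f -> fl_carrier g ->
    ae_on a b (fun t => cmod (f t) <= cmod (g t)) ->
    fl_norm f <= fl_norm g ;
  fl_indic : forall B : set R, B `<=` `[a, b] -> measurable B ->
    (@lebesgue_measure R B < +oo)%E -> fl_carrier (cindic B) ;
  fl_complete : forall u : nat -> R -> R[i],
    (forall m, fl_carrier (u m)) ->
    (forall e : R, 0 < e -> exists M : nat, forall p q : nat,
       (M <= p)%N -> (M <= q)%N -> fl_norm (fun t => u p t - u q t) < e) ->
    exists2 f, fl_carrier f &
      (fun m => fl_norm (fun t => u m t - f t)) @ \oo --> (0 : R)
}.

Definition distr_fun (R : realType) (a b : R) (h : R -> R[i]) (y : R)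
    : \bar R :=
  @lebesgue_measure R [set t | t \in `[a, b] /\ y <= cmod (h t)].

Definition rearrangement_invariant (R : realType) (a b : R)
    (X : function_lattice a b) : Prop :=
  forall f g, fl_carrier X f -> fl_carrier X g ->
    distr_fun a b f = distr_fun a b g -> fl_norm X f = fl_norm X g.

Definition exp_span (R : realType) (n : nat) (lam : 'I_n.+1 -> R)
    : set (R -> R[i]) :=
  [set P | exists c : 'I_n.+1 -> R[i],
     P = fun t => \sum_(j < n.+1) c j * (expR (lam j * t))%:C].

Definition gamma_exp (R : realType) (n : nat) (lam : 'I_n.+1 -> R) : R :=
  n%:R ^+ 2 + \sum_(j < n.+1) `|lam j|.

Definition Omega (R : realType) (a b : R) (N k : nat) : set R :=
  `[a + (b - a) * (k%:R - 1) / N%:R, a + (b - a) * k%:R / N%:R]%classic.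

Definition sample_step (R : realType) (a b : R) (N : nat) (P : R -> R[i])
    (x : nat -> R) : R -> R[i] :=
  fun t => \sum_(1 <= k < N.+1) (cmod (P (x k)))%:C * cindic (Omega a b N k) t.

(* Main.v *)
(* The theorem rests on a Bernstein inequality in [X]:
   [||P'|| <= K gamma(Lambda) ||P||] for [P] in [E(Lambda)], with [K] depending
   on [a, b] only.  Iterating it and summing the Taylor series of [P] at [t],
   the sampled step function differs from [|P|] by at most
   [exp (K gamma (b - a) / N) - 1 <= 1/2] times [||P||] once
   [N >= 4 K (b - a) gamma].

   The Bernstein inequality in [X] follows from its sup-norm version at an
   endpoint: by finite-dimensional duality [|P'(0)| <= C gamma max_[0,L] |P|]
   is the same as a quadrature [P'(t) = sum_i w_i P(t + g_i)] with nodes in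
   [0,L] and [sum_i |w_i| <= C gamma], and translations do not increase the
   norm of a rearrangement invariant space.  One uses [L = (b - a) / 2],
   forward translates on the left half of [a,b] and backward ones on the right.

   The sup-norm inequality combines three steps, with [r] exponents on [0,L].
   (1) The exponentials with exponent at least [24 r / L] are removed by
   subtracting from [P] a combination of its forward translates of total weight
   at most 1/4; the derivative of that combination is absorbed since it is at
   most a quarter of [max |P'|].
   (2) After multiplication by [exp (- A t)], [A = 28 r / L], the remaining sum
   is bounded on the whole half-line by its maximum on [0,L/2].
   (3) Newman's inequality [|Q'(0)| <= C (sum_j mu_j) sup_[0,oo) |Q|] for sums
   of decaying exponentials [exp (- mu_j t)].
   Steps (1) and (2) both reduce [x^N] modulo [prod_l (x - q_l)] in Newton's
   interpolation form.  Step (3) is Newman's contour integral, here an average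
   over roots of unity. *)

Require Import Defs.
From HB Require Import structures.
From mathcomp Require Import all_boot all_order all_algebra.
From mathcomp Require Import complex.
From mathcomp Require Import all_classical all_reals all_analysis.
From mathcomp Require Import measurable_realfun.
From mathcomp Require Import cyclic separable cyclotomic.
From mathcomp Require Import ring lra zify.

Set Implicit Arguments.
Unset Strict Implicit.
Unset Printing Implicit Defensive.

Import Order.TTheory GRing.Theory Num.Theory.
Import numFieldNormedType.Exports.

Local Open Scope classical_set_scope.
Local Open Scope complex_scope.
Local Open Scope ring_scope.

(** * Newton interpolation of powers *)

(** Divided difference of the power x^N at the nodes q_0, ..., q_i; equivalently, the complete
    homogeneous symmetric polynomial of degree N - i in these nodes. *)
Fixpoint newton_coef (R : realType) (q : nat -> R) (N i : nat) : R :=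
  match N, i with
  | 0, 0 => 1
  | 0, _.+1 => 0
  | M.+1, 0 => q 0%N * newton_coef q M 0
  | M.+1, k.+1 => newton_coef q M k + q k.+1 * newton_coef q M k.+1
  end.

Lemma newton_coef_small (R : realType) (q : nat -> R) (N i : nat) :
  (N < i)%N -> newton_coef q N i = 0.
Proof.
elim: N i => [|N IH] [|i] //= Ni.
by rewrite !IH ?mulr0 ?addr0// ltnW.
Qed.

Lemma newton_coefS (R : realType) (q : nat -> R) (N i : nat) :
  newton_coef q N.+1 i =
  (if i is k.+1 then newton_coef q N k else 0) + q i * newton_coef q N i.
Proof. by case: i => [|i] //=; rewrite add0r. Qed.

(** Induction on N: writing x = (x - q_i) + q_i, multiplication by x sends the i-th Newton product
    to the next one plus q_i times itself, which is the recursion of [newton_coef]. *)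
Lemma newton_pow (R : realType) (q : nat -> R) (x : R) (N : nat) :
  x ^+ N = \sum_(i < N.+1) newton_coef q N i * \prod_(l < i) (x - q l).
Proof.
elim: N => [|N IH].
  by rewrite big_ord_recl !big_ord0 addr0 mulr1 expr0.
under eq_bigr do rewrite newton_coefS mulrDl.
rewrite big_split /= big_ord_recl /= mul0r add0r.
rewrite [X in _ + X]big_ord_recr /= newton_coef_small// mulr0 mul0r addr0.
rewrite exprS IH mulr_sumr -big_split /=; apply: eq_bigr => i _.
rewrite /bump /= add1n big_ord_recr /=; ring.
Qed.

(* Interpolation at [q j] only sees the first [j.+1] Newton terms. *)
Lemma newton_pow_trunc (R : realType) (q : nat -> R) (r N j : nat) :
  (j < r)%N -> (r <= N.+1)%N ->
  q j ^+ N = \sum_(i < r) newton_coef q N i * \prod_(l < i) (q j - q l).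
Proof.
move=> jr rN; rewrite (newton_pow q).
rewrite -(big_mkord xpredT
  (fun i => newton_coef q N i * \prod_(l < i) (q j - q l))).
rewrite (big_cat_nat (n := r)) //= [X in _ + X]big1_seq ?addr0 ?big_mkord//.
move=> i /=; rewrite mem_index_iota => /andP[ri _]; have ji : (j < i)%N by apply: leq_trans ri.
by rewrite (bigD1 (Ordinal ji)) //= subrr mul0r mulr0.
Qed.

(** There are binomial(N, i) monomials of degree N - i in q_0, ..., q_i, each at most Q^(N - i); the
    induction step is Pascal's rule. *)
Lemma newton_coef_bound (R : realType) (q : nat -> R) (Q : R) (N i : nat) :
  (forall l, 0 <= q l <= Q) ->
  0 <= newton_coef q N i /\
  (newton_coef q N i <= 'C(N, i)%:R * Q ^+ (N - i)).
Proof.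
move=> hq; have Q0 : 0 <= Q by case/andP: (hq 0%N) => h1 h2; exact: le_trans h2.
elim: N i => [|N IH] i.
  by case: i => [|i] /=; rewrite ?bin0 ?bin0n ?mul1r ?expr0 ?mul0r ?ler01 ?lexx.
case: i => [|i].
  have [h1 h2] := IH 0%N; have /andP[q0 q1] := hq 0%N.
  rewrite /= bin0 mul1r subn0 exprS; split; first exact: mulr_ge0.
  by move: h2; rewrite bin0 mul1r subn0 => h2; exact: ler_pM.
have [h1 h2] := IH i; have [h3 h4] := IH i.+1; have /andP[q0 q1] := hq i.+1.
rewrite /=; split; first by rewrite addr_ge0// mulr_ge0.
have [Ni|iN] := leqP N i.
  rewrite (newton_coef_small q (N:=N) (i:=i.+1))// mulr0 addr0.
  rewrite subSS (le_trans h2)// ler_wpM2r ?exprn_ge0// ler_nat.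
  by rewrite binS leq_addl.
rewrite binS natrD mulrDl addrC subSS lerD//.
rewrite -subSS subSn// exprS mulrCA; exact: ler_pM.
Qed.

Lemma newton_coef_sum (R : realType) (q : nat -> R) (Q : R) (r N : nat) :
  (forall l, 0 <= q l <= Q) ->
  \sum_(i < r) newton_coef q N i * (1 + Q) ^+ i <=
  \sum_(i < r) 'C(N, i)%:R * Q ^+ (N - i) * (1 + Q) ^+ i.
Proof.
move=> hq; have Q0 : 0 <= Q by case/andP: (hq 0%N) => h1 h2; exact: le_trans h2.
apply: ler_sum => i _; apply: ler_wpM2r; first by rewrite exprn_ge0// addr_ge0.
by have [] := newton_coef_bound N i hq.
Qed.

(** The left side consists of the first r terms of the binomial expansion of (Q + (1 + Q))^N. *)
Lemma binomial_trunc (R : realType) (Q : R) (r N : nat) :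
  0 <= Q -> (r <= N.+1)%N ->
  \sum_(i < r) 'C(N, i)%:R * Q ^+ (N - i) * (1 + Q) ^+ i <= (1 + 2 * Q) ^+ N.
Proof.
move=> Q0 rN; rewrite (_ : 1 + 2 * Q = Q + (1 + Q)); last by ring.
rewrite exprDn -(big_mkord xpredT
  (fun i => 'C(N, i)%:R * Q ^+ (N - i) * (1 + Q) ^+ i)).
rewrite -(big_mkord xpredT (fun i => Q ^+ (N - i) * (1 + Q) ^+ i *+ 'C(N, i))).
rewrite [leRHS](big_cat_nat (n := r)) //=.
rewrite -[leLHS]addr0 lerD//.
  by apply: ler_sum => i _; rewrite -mulrA mulr_natl.
by apply: sumr_ge0 => i _; rewrite mulrn_wge0// mulr_ge0// exprn_ge0// addr_ge0.
Qed.

(** For i < r the power of 1/8 is at least 3r, while the binomials sum to at most 16^r and (9/8)^i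
    <= 2^r. The product (16 * 2 / 512)^r is at most (1/4)^r. *)
Lemma newton_sum_le_quarter (R : realType) (q : nat -> R) (r : nat) :
  (0 < r)%N -> (forall l, 0 <= q l <= 8^-1) ->
  \sum_(i < r) newton_coef q (4 * r) i * (1 + 8^-1) ^+ i <= 4^-1 :> R.
Proof.
move=> r0 hq; apply: (le_trans (newton_coef_sum _ _ hq)).
have H (i : 'I_r) : 'C(4 * r, i)%:R * (8^-1 : R) ^+ (4 * r - i) * (1 + 8^-1) ^+ i
    <= 'C(4 * r, i)%:R * (8^-1 ^+ (3 * r) * 2 ^+ r).
  rewrite -mulrA ler_wpM2l//; apply: ler_pM; rewrite ?exprn_ge0//.
    apply: ler_wiXn2l; [by rewrite invr_ge0|by rewrite invf_le1// ler1n|].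
    by have := ltn_ord i; lia.
  apply: (@le_trans _ _ (2 ^+ i)); first by apply: lerXn2r; rewrite ?nnegrE; lra.
  by rewrite ler_weXn2l//; [lra|exact: ltnW].
apply: (le_trans (ler_sum _ (fun i _ => H i))).
rewrite -mulr_suml -natr_sum.
have B : (\sum_(i < r) 'C(4 * r, i) <= 2 ^ (4 * r))%N.
  have -> : (2 ^ (4 * r) = (1 + 1) ^ (4 * r))%N by [].
  rewrite expnDn.
  rewrite -(big_mkord xpredT (fun i => 'C(4 * r, i))).
  rewrite -(big_mkord xpredT
    (fun i => 'C(4 * r, i) * (1 ^ (4 * r - i) * 1 ^ i)))%N.
  rewrite [leqRHS](big_cat_nat (n := r)) //=; last by lia.
  apply: leq_trans (leq_addr _ _).
  by apply: leq_sum => i _; rewrite !exp1n !muln1.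
apply: (@le_trans _ _ ((2 ^ (4 * r))%:R * (8^-1 ^+ (3 * r) * 2 ^+ r))).
  rewrite ler_wpM2r ?ler_nat// mulr_ge0// exprn_ge0//; lra.
rewrite natrX !exprM -!exprMn.
apply: (@le_trans _ _ (4^-1 ^+ r)).
  apply: lerXn2r; rewrite ?nnegrE; lra.
rewrite -[leRHS]expr1; apply: ler_wiXn2l => //; lra.
Qed.

(** * Translates of exponential sums *)

Definition expsum (R : realType) (r : nat) (lam c : 'I_r -> R) (t : R) : R :=
  \sum_(j < r) c j * expR (lam j * t).

(** The operator prod_(l < i) (T_h - q_l) applied to the exponential sum, T_h being translation by
    h: each exponential is an eigenvector of T_h. *)
Definition newton_shift (R : realType) (r : nat) (lam c : 'I_r -> R)
    (h : R) (q : nat -> R) (i : nat) (t : R) : R :=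
  expsum lam (fun j => c j * \prod_(l < i) (expR (lam j * h) - q l)) t.

(** Each factor T_h - q_l costs at most 1 + Q and one more translate. *)
Lemma newton_shift_bound (R : realType) (r : nat) (lam c : 'I_r -> R) (h : R)
    (q : nat -> R) (Q W : R) (i : nat) (t : R) :
  (forall l, 0 <= q l <= Q) ->
  (forall k, (k <= i)%N -> `|expsum lam c (t + k%:R * h)| <= W) ->
  `|newton_shift lam c h q i t| <= (1 + Q) ^+ i * W.
Proof.
move=> hq; have Q0 : 0 <= Q by case/andP: (hq 0%N) => h1 h2; exact: le_trans h2.
elim: i t => [|i IH] t hW.
  rewrite expr0 mul1r; have := hW 0%N (leqnn _); rewrite mul0r addr0.
  by congr (`|_| <= _); apply: eq_bigr => j _; rewrite big_ord0 mulr1.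
have -> : newton_shift lam c h q i.+1 t =
    newton_shift lam c h q i (t + h) - q i * newton_shift lam c h q i t.
  rewrite /newton_shift /expsum mulr_sumr -sumrB; apply: eq_bigr => j _.
  rewrite big_ord_recr /= [lam j * (t + h)]mulrDr expRD; ring.
apply: (le_trans (ler_normB _ _)); rewrite exprS mulrDl mul1r mulrDl -mulrA.
have /andP[q0 q1] := hq i.
rewrite lerD//.
- apply: IH => k ki; have := hW k.+1 ki.
  by rewrite -natr1 mulrDl mul1r [_ * h + h]addrC addrA.
- rewrite normrM ger0_norm//; apply: ler_pM => //; apply: IH => k ki.
  by apply: hW; rewrite leqW.
Qed.

Lemma sum_newton_shift (R : realType) (r m : nat) (lam c : 'I_r -> R) (h : R)
    (q a : nat -> R) (t : R) :
  \sum_(i < m) a i * newton_shift lam c h q i t =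
  expsum lam (fun j => c j *
    \sum_(i < m) a i * \prod_(l < i) (expR (lam j * h) - q l)) t.
Proof.
rewrite /newton_shift /expsum; under eq_bigr do rewrite mulr_sumr.
rewrite exchange_big /=; apply: eq_bigr => j _.
by rewrite mulr_sumr mulr_suml; apply: eq_bigr => i _; ring.
Qed.

(** T_h is annihilated by prod_j (x - e^(lam_j h)), so T_h^N reduces to Newton operators of order
    below r, which only use values on [0, L]. The weights add up to at most 3^N <= e^(2N). *)
Lemma expsum_ext_bound (R : realType) (r : nat) (lam c : 'I_r -> R) (L W s : R) :
  (0 < r)%N -> 0 < L -> (forall j, lam j <= 0) -> 0 <= s ->
  (forall t, 0 <= t <= L -> `|expsum lam c t| <= W) ->
  `|expsum lam c s| <= W * expR (2 * (s * r%:R / L)).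
Proof.
move=> r0 L0 lam0 s0 hW.
have W0 : 0 <= W by apply: le_trans (hW 0 _); rewrite // lexx ltW.
have rR : 0 < r%:R :> R by rewrite ltr0n.
have [sL|Ls] := leP s L.
  apply: (le_trans (hW _ _)); first by rewrite s0.
  rewrite ler_peMr// -expR0 ler_expR; apply: mulr_ge0 => //.
  by apply: divr_ge0; [apply: mulr_ge0|apply: ltW].
(* Write s = t0 + N h with 0 <= t0 < h; the points t0 + k h with k < r then stay in [0, L]. *)
pose h := L / r%:R; have h0 : 0 < h by rewrite divr_gt0.
have Lh : L = r%:R * h by rewrite /h mulrCA divff ?mulr1// gt_eqF.
pose N := Num.truncn (s / h).
have /andP[N1 N2] : N%:R <= s / h < N.+1%:R.
  by apply: truncn_itv; rewrite divr_ge0// ltW.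
pose t0 := s - N%:R * h.
have t00 : 0 <= t0 by rewrite subr_ge0 -ler_pdivlMr.
have t0h : t0 < h by rewrite ltrBlDr -{1}[h]mul1r -mulrDl addrC natr1 -ltr_pdivrMr.
have rN : (r <= N)%N.
  rewrite -ltnS -(ltr_nat R); apply: lt_trans N2.
  by rewrite ltr_pdivlMr// -Lh.
(* The default 0 extends the r nodes to all indices while keeping them in [0, 1]. *)
pose q l := if insub l is Some j then expR (lam j * h) else 0.
have hq l : 0 <= q l <= 1.
  rewrite /q; case: insubP => [j _ _|_]; last by rewrite lexx ler01.
  by rewrite expR_ge0 -expR0 ler_expR mulr_le0_ge0// ltW.
have qE (j : 'I_r) : q j = expR (lam j * h) by rewrite /q valK.
have E : expsum lam c s =
    \sum_(i < r) newton_coef q N i * newton_shift lam c h q i t0.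
  rewrite sum_newton_shift; apply: eq_bigr => j _.
  under eq_bigr do rewrite -qE.
  rewrite -(newton_pow_trunc _ (ltn_ord j)) ?leqW// qE -expRM_natl mulrAC -mulrA -expRD.
  by congr (_ * expR _); rewrite /t0; ring.
rewrite E; apply: (le_trans (ler_norm_sum _ _ _)).
apply: (@le_trans _ _ (\sum_(i < r) newton_coef q N i * (1 + 1) ^+ i * W)).
  apply: ler_sum => i _; have [a0 _] := newton_coef_bound N i hq.
  rewrite normrM ger0_norm// -mulrA ler_wpM2l//.
  apply: newton_shift_bound => // k ki; apply: hW.
  rewrite addr_ge0//=; last by rewrite mulr_ge0// ltW.
  have kr : (k.+1 <= r)%N by apply: leq_ltn_trans ki _.
  rewrite Lh; apply: (@le_trans _ _ (h + k%:R * h)).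
    by rewrite lerD2r ltW.
  have -> : h + k%:R * h = k.+1%:R * h by rewrite -natr1; ring.
  by rewrite ler_wpM2r ?ler_nat// ltW.
rewrite -mulr_suml mulrC ler_wpM2l//.
apply: (le_trans (newton_coef_sum _ _ hq)).
apply: (le_trans (binomial_trunc _ _)) => //; first exact: leqW.
apply: (@le_trans _ _ (expR 2 ^+ N)).
  apply: lerXn2r; rewrite ?nnegrE ?expR_ge0//.
  apply: le_trans (expR_ge1Dx _); lra.
rewrite -expRM_natl ler_expR mulrC ler_wpM2l//.
apply: (le_trans N1); rewrite /h; rewrite invf_div mulrA; exact: lexx.
Qed.

(* Subtracting a combination of forward translates, of total weight at most
   1/4, removes every exponential whose exponent is at least [24 r / L]. *)
Lemma expsum_remove_large (R : realType) (r : nat) (lam : 'I_r -> R) (L : R) :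
  (0 < r)%N -> 0 < L ->
  exists2 e : 'I_r -> R,
    forall j, 24 * r%:R / L <= lam j -> e j = 0 &
    forall (c : 'I_r -> R) (W t : R),
      (forall s, t <= s <= t + L / 2 -> `|expsum lam c s| <= W) ->
      `|expsum lam (fun j => c j * (1 - e j)) t| <= 4^-1 * W.
Proof.
move=> r0 L0; have rR : 0 < r%:R :> R by rewrite ltr0n.
(* With N = 4r steps the translates span N h = L / 2, and an exponent of at least 24 r / L satisfies
   lam_j h >= 3, so that e^(- lam_j h) <= e^(-3) <= 1/8. *)
pose h := L / (8 * r%:R); have h0 : 0 < h by rewrite divr_gt0// mulr_gt0.
pose N := (4 * r)%N.
have Nh : N%:R * h = L / 2 by rewrite /N /h natrM; field; rewrite gt_eqF.
pose q l := if insub l is Some j then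
    (if 3 <= lam j * h then expR (lam j * - h) else 0) else 0.
have hq l : 0 <= q l <= 8^-1.
  rewrite /q; case: insubP => [j _ _|_]; last by rewrite lexx /= invr_ge0 ler0n.
  case: ifP => hj; last by rewrite lexx /= invr_ge0 ler0n.
  rewrite expR_ge0 mulrN expRN lef_pV2 ?posrE ?expR_gt0//=.
  apply: (@le_trans _ _ (expR 3)); last by rewrite ler_expR.
  have -> : (3 : R) = 3%:R * 1 by ring.
  rewrite expRM_natl (_ : 8 = 2 ^+ 3 :> R); last by ring.
  apply: lerXn2r; rewrite ?nnegrE ?expR_ge0//.
  by apply: le_trans (expR_ge1Dx _); lra.
have qE (j : 'I_r) : 3 <= lam j * h -> q j = expR (lam j * - h).
  by rewrite /q valK => ->.
(* The subtracted operator starts from t + N h and steps backward; it multiplies the j-th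
   exponential by 1 - e_j. At an interpolated node this multiplier is e^(lam_j N h) e^(- lam_j N h)
   = 1. *)
pose e j := 1 - expR (lam j * (N%:R * h)) * \sum_(i < r) newton_coef q N i *
  \prod_(l < i) (expR (lam j * - h) - q l).
exists e => [j hj|c W t hW].
  have hj' : 3 <= lam j * h.
    have -> : 3 = (24 * r%:R / L) * h :> R.
      by rewrite /h; field; rewrite !gt_eqF.
    by rewrite ler_wpM2r// ltW.
  rewrite /e -(qE _ hj') -(newton_pow_trunc _ (ltn_ord j)) ?qE//; last first.
    by rewrite /N; lia.
  rewrite -expRM_natl -expRD.
  have -> : lam j * (N%:R * h) + N%:R * (lam j * - h) = 0 by ring.
  by rewrite expR0 subrr.
have -> : expsum lam (fun j => c j * (1 - e j)) t =
    \sum_(i < r) newton_coef q N i * newton_shift lam c (- h) q i (t + L / 2).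
  rewrite sum_newton_shift; apply: eq_bigr => j _.
  rewrite /e opprB addrCA subrr addr0 mulrDr expRD Nh; ring.
apply: (le_trans (ler_norm_sum _ _ _)).
have W0 : 0 <= W by apply: le_trans (hW t _); rewrite // lexx/= lerDl divr_ge0// ltW.
apply: le_trans (ler_wpM2r W0 (newton_sum_le_quarter r0 hq)).
rewrite mulr_suml; apply: ler_sum => i _; have [a0 _] := newton_coef_bound N i hq.
rewrite normrM ger0_norm// -mulrA ler_wpM2l//.
apply: newton_shift_bound => // k ki; apply: hW.
rewrite mulrN lerBlDr lerDl mulr_ge0// ?(ltW h0)// andbT -addrA lerDl subr_ge0.
rewrite -Nh ler_wpM2r ?(ltW h0)// ler_nat.
by apply: (leq_trans ki); have := ltn_ord i; rewrite /N; lia.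
Qed.

(** * The Laplace transform of an exponential sum *)

Lemma is_derive1_add (R : realType) (f g : R -> R) (t a b : R) :
  is_derive t 1 f a -> is_derive t 1 g b ->
  is_derive t 1 (fun s => f s + g s) (a + b).
Proof. by move=> hf hg; exact: is_deriveD. Qed.

Lemma is_derive1_mul (R : realType) (f g : R -> R) (t a b : R) :
  is_derive t 1 f a -> is_derive t 1 g b ->
  is_derive t 1 (fun s => f s * g s) (f t * b + g t * a).
Proof. by move=> hf hg; exact: is_deriveM. Qed.

Lemma is_derive1_scale (R : realType) (k : R) (f : R -> R) (t a : R) :
  is_derive t 1 f a -> is_derive t 1 (fun s => k * f s) (k * a).
Proof. by move=> hf; exact: is_deriveZ. Qed.

Lemma is_derive1_lin (R : realType) (k t : R) : is_derive t 1 (fun s => k * s) k.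
Proof.
by rewrite -[X in is_derive _ _ _ X]mulr1; apply: is_derive1_scale.
Qed.

Lemma is_derive1_comp_lin (R : realType) (k t a : R) (f : R -> R) :
  is_derive (k * t) 1 f a -> is_derive t 1 (fun s => f (k * s)) (k * a).
Proof.
move=> hf; rewrite mulrC.
exact: (@is_derive1_comp _ f (fun s => k * s) t a k hf (is_derive1_lin _ _)).
Qed.

Lemma is_derive1_bigsum (R : realType) (r : nat) (h : 'I_r -> R -> R) (t : R)
    (dh : 'I_r -> R) : (forall j, is_derive t 1 (h j) (dh j)) ->
  is_derive t 1 (fun s => \sum_(j < r) h j s) (\sum_(j < r) dh j).
Proof.
move=> H; rewrite (_ : (fun s => _) = \sum_(j < r) h j); first exact: is_derive_sum.
by apply/funext => s; rewrite fct_sumE.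
Qed.

Lemma is_derive_expsum (R : realType) (r : nat) (lam c : 'I_r -> R) (t : R) :
  is_derive t 1 (expsum lam c) (expsum lam (fun j => c j * lam j) t).
Proof.
apply: is_derive1_bigsum => j; rewrite -mulrA; apply: is_derive1_scale.
by apply: is_derive1_comp_lin; exact: is_derive_expR.
Qed.

Lemma ge0_derive_le (R : realType) (f df : R -> R) (a b : R) :
  (forall t : R, is_derive t 1 f (df t)) ->
  (forall t, a <= t <= b -> 0 <= df t) -> a <= b -> f a <= f b.
Proof.
move=> hf hdf ab.
have [c cab E] : exists2 c, c \in `[a, b]%R & f b - f a = df c * (b - a).
  apply: MVT_segment => //; apply: derivable_within_continuous => x _.
  by have [] := hf x.
rewrite -subr_ge0 E mulr_ge0 ?subr_ge0//; apply: hdf; by rewrite in_itv in cab.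
Qed.

Lemma cos_sin_comb_le (R : realType) (u v t : R) :
  u ^+ 2 + v ^+ 2 <= 1 -> `|u * cos t + v * sin t| <= 1.
Proof.
move=> uv; rewrite -[leRHS]ger0_norm// -ler_sqr ?nnegrE// !real_normK ?num_real// expr1n.
apply: le_trans uv; have E := cos2Dsin2 t.
have -> : u ^+ 2 + v ^+ 2 = (u ^+ 2 + v ^+ 2) * (cos t ^+ 2 + sin t ^+ 2).
  by rewrite E mulr1.
have := sqr_ge0 (u * sin t - v * cos t); lra.
Qed.

(* [\sum_j d_j / (x + mu_j + i y)] with complex numerators is the Laplace
   transform at [x + i y]; the real and imaginary parts of the quotients are
   called [al] and [be], and [u + i v] is the phase of the numerators. *)
Lemma laplace_bound_real (R : realType) (r : nat) (mu c al be : 'I_r -> R)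
    (x y u v W : R) :
  0 < x -> (forall j, 0 <= mu j) -> u ^+ 2 + v ^+ 2 <= 1 ->
  (forall j, (x + mu j) * al j - y * be j = c j * u) ->
  (forall j, (x + mu j) * be j + y * al j = c j * v) ->
  (forall t : R, 0 <= t -> `|expsum (fun j => - mu j) c t| <= W) ->
  \sum_(j < r) al j <= W / x.
Proof.
move=> x0 mu0 uv h1 h2 hW.
pose p := expsum (fun j => - mu j) c.
(* [phi s] is the real part of (u + i v) times the integral over [s, oo) of e^(-(x + i y) t) p(t),
   written in closed form. *)
pose phi s := \sum_(j < r)
  expR (- (x + mu j) * s) * (al j * cos (y * s) + be j * sin (y * s)).
have dphi (s : R) : is_derive s 1 phi
    (- (u * cos (y * s) + v * sin (y * s)) * (expR (- x * s) * p s)).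
  have -> : - (u * cos (y * s) + v * sin (y * s)) * (expR (- x * s) * p s) =
    \sum_(j < r) (expR (- (x + mu j) * s) *
      (al j * (y * - sin (y * s)) + be j * (y * cos (y * s))) +
     (al j * cos (y * s) + be j * sin (y * s)) *
      (- (x + mu j) * expR (- (x + mu j) * s))).
    rewrite /p /expsum !mulr_sumr; apply: eq_bigr => j _.
    have -> : expR (- (x + mu j) * s) = expR (- x * s) * expR (- mu j * s).
      by rewrite -expRD; congr expR; ring.
    set ex := expR (- x * s); set em := expR (- mu j * s).
    set C := cos _; set S := sin _.
    transitivity (- ((c j * u) * C + (c j * v) * S) * (ex * em)); first by ring.
    by rewrite -h1 -h2; ring.
  apply: is_derive1_bigsum => j; apply: is_derive1_mul.
    by apply: is_derive1_comp_lin; exact: is_derive_expR.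
  by apply: is_derive1_add; apply: is_derive1_scale; apply: is_derive1_comp_lin.
(* The subtracted term is the integral of the majorant W e^(- x t) over [s, oo), so [psi] is
   nondecreasing. As it is at most K e^(- x s), it cannot start above 0. *)
pose psi s := phi s + - (W / x) * expR (- x * s).
have dpsi (s : R) : is_derive s 1 psi
    (- (u * cos (y * s) + v * sin (y * s)) * (expR (- x * s) * p s) +
     - (W / x) * (- x * expR (- x * s))).
  apply: is_derive1_add.
  by apply: is_derive1_scale; apply: is_derive1_comp_lin; exact: is_derive_expR.
have W0 : 0 <= W by apply: le_trans (hW 0 (lexx _)).
have psi0 (s : R) : 0 <= s -> psi 0 <= psi s.
  apply: ge0_derive_le => // t /andP[t0 _].
  have -> : - (W / x) * (- x * expR (- x * t)) = W * expR (- x * t).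
    by field; rewrite gt_eqF.
  rewrite mulrCA [W * _]mulrC -mulrDr mulr_ge0 ?expR_ge0//.
  rewrite mulNr addrC subr_ge0.
  apply: (le_trans (ler_norm _)); rewrite normrM.
  apply: (@le_trans _ _ (1 * W)); last by rewrite mul1r.
  apply: ler_pM => //; [exact: cos_sin_comb_le|exact: hW].
pose K := \sum_(j < r) (`|al j| + `|be j|).
have K0 : 0 <= K by apply: sumr_ge0 => j _; apply: addr_ge0.
have psiK (s : R) : 0 <= s -> psi s <= K * expR (- x * s).
  move=> s0; apply: (@le_trans _ _ (phi s)).
    by rewrite /psi mulNr lerBlDr lerDl mulr_ge0 ?expR_ge0// divr_ge0// ltW.
  rewrite /phi /K mulr_suml; apply: ler_sum => j _.
  rewrite mulrC; apply: (@le_trans _ _ (`|al j * cos (y * s) + be j * sin (y * s)| *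
      expR (- (x + mu j) * s))).
    by rewrite ler_wpM2r ?expR_ge0// ler_norm.
  apply: ler_pM; rewrite ?expR_ge0//.
    apply: (le_trans (ler_normD _ _)); rewrite !normrM lerD// ler_piMr//.
      by rewrite ler_norml cos_geN1 cos_le1.
    by rewrite ler_norml sin_geN1 sin_le1.
  by rewrite ler_expR ler_wpM2r// lerN2 lerDl.
have -> : \sum_(j < r) al j = phi 0.
  apply: eq_bigr => j _; rewrite !mulr0 expR0 cos0 sin0; ring.
have {psi0 psiK}psi0 (s : R) : 0 <= s -> psi 0 * (1 + x * s) <= K.
  move=> s0; rewrite -ler_pdivlMr ?ltr_wpDr ?mulr_ge0 ?(ltW x0)//.
  apply: (le_trans (psi0 _ s0)); apply: (le_trans (psiK _ s0)).
  rewrite mulNr expRN ler_wpM2l// lef_pV2 ?posrE ?expR_gt0 ?ltr_wpDr ?mulr_ge0 ?(ltW x0)//.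
  exact: expR_ge1Dx.
have : psi 0 <= 0.
  rewrite leNgt; apply/negP => ps.
  (* At this s the bound psi(0) (1 + x s) <= K becomes psi(0) + K <= K. *)
  have := psi0 (K / psi 0 / x) (divr_ge0 (divr_ge0 K0 (ltW ps)) (ltW x0)).
  have -> : psi 0 * (1 + x * (K / psi 0 / x)) = psi 0 + K.
    by field; rewrite !gt_eqF.
  by rewrite gerDr leNgt ps.
by rewrite /psi mulr0 expR0 mulr1 subr_le0.
Qed.

(** * Averages over a circle in the complex plane *)

Lemma cmod_ge0 (R : realType) (z : R[i]) : 0 <= cmod z.
Proof. by case: z => a b; exact: sqrtr_ge0. Qed.

Lemma cmodM (R : realType) (z w : R[i]) : cmod (z * w) = cmod z * cmod w.
Proof. exact: ComplexField.Normc.normcM. Qed.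

Lemma cmodV (R : realType) (z : R[i]) : cmod z^-1 = (cmod z)^-1.
Proof. exact: ComplexField.Normc.normcV. Qed.

Lemma cmodD (R : realType) (z w : R[i]) : cmod (z + w) <= cmod z + cmod w.
Proof. exact: le_normcD. Qed.

Lemma cmodN (R : realType) (z : R[i]) : cmod (- z) = cmod z.
Proof. exact: normcN. Qed.

Lemma cmodB (R : realType) (z w : R[i]) : cmod (z - w) <= cmod z + cmod w.
Proof. by apply: (le_trans (cmodD _ _)); rewrite cmodN. Qed.

Lemma cmod0 (R : realType) : cmod (0 : R[i]) = 0.
Proof. exact: ComplexField.Normc.normc0. Qed.

Lemma cmod1 (R : realType) : cmod (1 : R[i]) = 1.
Proof. exact: ComplexField.Normc.normc1. Qed.

Lemma cmod_eq0 (R : realType) (z : R[i]) : cmod z = 0 -> z = 0.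
Proof. exact: ComplexField.Normc.eq0_normc. Qed.

Lemma cmod_real (R : realType) (x : R) : cmod x%:C = `|x|.
Proof. by rewrite /cmod /= expr0n addr0 sqrtr_sqr. Qed.

Lemma cmodX (R : realType) (z : R[i]) (n : nat) : cmod (z ^+ n) = cmod z ^+ n.
Proof. by elim: n => [|n IH]; rewrite ?expr0 ?cmod1// !exprS cmodM IH. Qed.

Lemma cmod_prod (R : realType) (I : Type) (s : seq I) (P : pred I) (F : I -> R[i]) :
  cmod (\prod_(i <- s | P i) F i) = \prod_(i <- s | P i) cmod (F i).
Proof. by apply: (big_morph _ (@cmodM R) (@cmod1 R)). Qed.

Lemma cmod_sum (R : realType) (I : Type) (s : seq I) (P : pred I) (F : I -> R[i]) :
  cmod (\sum_(i <- s | P i) F i) <= \sum_(i <- s | P i) cmod (F i).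
Proof.
elim/big_rec2: _ => [|i x y _ H]; first by rewrite cmod0.
by apply: (le_trans (cmodD _ _)); rewrite lerD2l.
Qed.

Lemma cmod_sqr (R : realType) (z : R[i]) :
  cmod z ^+ 2 = complex.Re z ^+ 2 + complex.Im z ^+ 2.
Proof. by case: z => a b; rewrite sqr_sqrtr// addr_ge0// sqr_ge0. Qed.

(* [f] is, on the unit circle, a uniform limit of polynomials in [1/w] with
   constant coefficient [c]; then [c] is its average over the circle. *)
Definition circle_mean (R : realType) (f : R[i] -> R[i]) (c : R[i]) : Prop :=
  forall d : R, 0 < d -> exists2 T : {poly R[i]}, T.[0] = c &
    forall w, cmod w = 1 -> cmod (f w - T.[w^-1]) <= d.

Lemma circle_mean_ext (R : realType) (f g : R[i] -> R[i]) (c : R[i]) :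
  (forall w, cmod w = 1 -> f w = g w) -> circle_mean f c -> circle_mean g c.
Proof.
move=> fg hf d d0; have [T T0 hT] := hf d d0.
by exists T => // w w1; rewrite -fg ?hT.
Qed.

Lemma circle_mean_cst (R : realType) (c : R[i]) : circle_mean (fun=> c) c.
Proof.
move=> d d0; exists c%:P => [|w _]; rewrite hornerC// subrr cmod0; exact: ltW.
Qed.

Lemma circle_meanD (R : realType) (f g : R[i] -> R[i]) (a b : R[i]) :
  circle_mean f a -> circle_mean g b ->
  circle_mean (fun w => f w + g w) (a + b).
Proof.
move=> hf hg d d0; have d2 : 0 < d / 2 by rewrite divr_gt0.
have [T T0 hT] := hf _ d2; have [U U0 hU] := hg _ d2.
exists (T + U) => [|w w1]; first by rewrite hornerD T0 U0.
rewrite hornerD opprD addrACA; apply: (le_trans (cmodD _ _)).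
rewrite (splitr d); apply: lerD; [exact: hT|exact: hU].
Qed.

Lemma circle_mean_bounded (R : realType) (f : R[i] -> R[i]) (c : R[i]) :
  circle_mean f c -> exists2 B : R, 0 < B & forall w, cmod w = 1 -> cmod (f w) <= B.
Proof.
move=> /(_ 1 ltr01)[T _ hT].
exists (1 + \sum_(i < size T) cmod T`_i) => [|w w1].
  by rewrite ltr_wpDr// sumr_ge0// => i _; exact: cmod_ge0.
rewrite -[f w](subrK T.[w^-1]); apply: (le_trans (cmodD _ _)).
apply: lerD; first exact: hT.
rewrite horner_coef; apply: (le_trans (cmod_sum _ _ _)).
by apply: ler_sum => i _; rewrite cmodM cmodX cmodV w1 invr1 expr1n mulr1.
Qed.

(** Polynomials in 1/w have no positive powers of w, so the constant coefficient of a product is the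
    product of the constant coefficients. *)
Lemma circle_meanM (R : realType) (f g : R[i] -> R[i]) (a b : R[i]) :
  circle_mean f a -> circle_mean g b ->
  circle_mean (fun w => f w * g w) (a * b).
Proof.
move=> hf hg d d0.
have [Bf Bf0 hBf] := circle_mean_bounded hf.
have [Bg Bg0 hBg] := circle_mean_bounded hg.
(* Chosen so that Bf d1 + d2 (Bg + d1) = d, where Bg + d1 bounds the polynomial approximating g. *)
pose d1 := d / (2 * Bf); pose d2 := d / (2 * (Bg + d1)).
have d10 : 0 < d1 by rewrite divr_gt0// mulr_gt0.
have d20 : 0 < d2 by rewrite divr_gt0// mulr_gt0// addr_gt0.
have [T T0 hT] := hf _ d20; have [U U0 hU] := hg _ d10.
exists (T * U) => [|w w1]; first by rewrite hornerM T0 U0.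
rewrite hornerM (_ : _ - _ = f w * (g w - U.[w^-1]) +
  (f w - T.[w^-1]) * U.[w^-1]); last by ring.
apply: (le_trans (cmodD _ _)); rewrite !cmodM.
have Ub : cmod U.[w^-1] <= Bg + d1.
  rewrite -[U.[w^-1]](subKr (g w)); apply: (le_trans (cmodB _ _)).
  by apply: lerD; [exact: hBg|exact: hU].
have -> : d = Bf * d1 + d2 * (Bg + d1).
  rewrite /d2 /d1; field; rewrite (gt_eqF Bf0) gt_eqF//.
  by rewrite addr_gt0// !mulr_gt0.
by apply: lerD; apply: ler_pM; rewrite ?cmod_ge0//; [exact: hBf|exact: hU|exact: hT].
Qed.

Lemma exp_small (R : realType) (x e : R) : 0 <= x < 1 -> 0 < e ->
  exists K : nat, x ^+ K <= e.
Proof.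
move=> /andP[x0 x1] e0.
have x1' : `|x| < 1 by rewrite ger0_norm.
have /cvgrPdist_le /(_ e e0) := cvg_expr x1'.
move=> [K _ /(_ K (leqnn K))] /=; rewrite sub0r normrN => H.
by exists K; apply: le_trans H; exact: ler_norm.
Qed.

(** Geometric series: 1 / (w - p) is the sum of p^k / w^(k + 1), without constant term; the
    remainder after K terms is at most |p|^K / (1 - |p|). *)
Lemma circle_mean_pole (R : realType) (p : R[i]) : cmod p < 1 ->
  circle_mean (fun w => (w - p)^-1) 0.
Proof.
move=> p1 d d0; have q0 := cmod_ge0 p.
have [K hK] : exists K : nat, cmod p ^+ K <= d * (1 - cmod p).
  by apply: exp_small; rewrite ?cmod_ge0// mulr_gt0// subr_gt0.
exists ('X * \sum_(k < K) (p *: 'X) ^+ k) => [|w w1].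
  by rewrite hornerM hornerX mul0r.
have wn : w != 0 by apply: contra_eq_neq w1 => ->; rewrite cmod0 eq_sym oner_neq0.
have wp : w - p != 0.
  by apply: contraTneq p1 => /eqP; rewrite subr_eq0 => /eqP <-; rewrite w1 ltxx.
have S1 : (\sum_(k < K) (p *: 'X) ^+ k).[w^-1] = \sum_(k < K) (p / w) ^+ k.
  by rewrite horner_sum; apply: eq_bigr => k _; rewrite horner_exp hornerZ hornerX.
have G : (1 - p / w) * \sum_(k < K) (p / w) ^+ k = 1 - (p / w) ^+ K.
  by have := subrX1 (p / w) K; rewrite -opprB => /eqP; rewrite eqr_oppLR => /eqP ->; ring.
have G2 : w^-1 * \sum_(k < K) (p / w) ^+ k = (1 - (p / w) ^+ K) / (w - p).
  by rewrite -G; field; rewrite wn wp.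
rewrite hornerM hornerX S1 G2 -[X in X - _]mul1r -mulrBl opprB addrCA subrr addr0.
rewrite cmodM cmodV cmodX cmodM cmodV w1 invr1 mulr1.
have wpb : 1 - cmod p <= cmod (w - p).
  by rewrite lerBlDr -w1 -{1}[w](subrK p); exact: cmodD.
have wp0 : 0 < cmod (w - p) by apply: lt_le_trans wpb; rewrite subr_gt0.
rewrite ler_pdivrMr//; apply: (le_trans hK); rewrite ler_wpM2l//; exact: ltW.
Qed.

(** X^n - 1 splits over the complex numbers and is separable, hence has n distinct roots, and among
    these one is primitive. *)
Lemma prim_root_complex (R : realType) (n : nat) : (0 < n)%N ->
  exists z : R[i], n.-primitive_root z.
Proof.
move=> n_gt0; pose p : {poly R[i]} := 'X^n - 1.
have [r Dp] := closed_field_poly_normal p.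
rewrite (monicP _) ?monicXnsubC // scale1r in Dp.
have rn1: all n.-unity_root r by apply/allP=> z; rewrite -root_prod_XsubC -Dp.
have sz_r: (n < (size r).+1)%N.
  by rewrite -(size_prod_XsubC r id) -Dp size_XnsubC.
have [|z] := hasP (has_prim_root n_gt0 rn1 _ sz_r); last by exists z.
by rewrite -separable_prod_XsubC -Dp separable_Xn_sub_1 // pnatr_eq0 -lt0n.
Qed.

Lemma prim_root_cmod (R : realType) (n : nat) (z : R[i]) (m : nat) :
  n.-primitive_root z -> cmod (z ^+ m) = 1.
Proof.
move=> hz; rewrite cmodX; have := prim_expr_order hz => /(congr1 (@cmod R)).
rewrite cmodX cmod1 => /eqP; rewrite pexpr_eq1 ?cmod_ge0 ?(prim_order_gt0 hz)//.
by move=> /eqP ->; rewrite expr1n.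
Qed.

Lemma sum_unity_root_pow (F : fieldType) (n k : nat) (u : F) :
  u ^+ n = 1 -> u ^+ k != 1 -> \sum_(m < n) (u ^+ m) ^+ k = 0.
Proof.
move=> un uk; have uk' : u ^+ k - 1 != 0 by rewrite subr_eq0.
apply: (mulfI uk'); rewrite mulr0.
under eq_bigr do rewrite exprAC.
by rewrite -subrX1 exprAC un expr1n subrr.
Qed.

(** Averaging over the n-th roots of unity annihilates every power w^(-k) with 0 < k < n. *)
Lemma sum_root_horner (R : realType) (n : nat) (z : R[i]) (T : {poly R[i]}) :
  n.-primitive_root z -> (size T <= n)%N ->
  \sum_(m < n) T.[(z ^+ m)^-1] = n%:R * T.[0].
Proof.
move=> hz sT; have n0 := prim_order_gt0 hz.
under eq_bigr do rewrite -exprVn (horner_coef_wide _ sT).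
rewrite exchange_big /= (bigD1 (Ordinal n0)) //= [X in _ + X]big1 => [|k k0].
  under eq_bigr do rewrite expr0 mulr1.
  by rewrite sumr_const card_ord addr0 mulr_natl horner_coef0.
rewrite -mulr_sumr sum_unity_root_pow ?mulr0//.
  by rewrite exprVn (prim_expr_order hz) invr1.
rewrite exprVn invr_eq1 -(prim_order_dvd hz) gtnNdvd// lt0n.
by apply: contraNneq k0 => k0; apply/eqP/val_inj.
Qed.

Lemma circle_mean_avg (R : realType) (f : R[i] -> R[i]) (c : R[i]) (d : R) :
  circle_mean f c -> 0 < d -> exists M0 : nat, forall (M : nat) (z : R[i]),
    (M0 <= M)%N -> M.-primitive_root z ->
    cmod (\sum_(m < M) f (z ^+ m) - M%:R * c) <= M%:R * d.
Proof.
move=> hf d0; have [T T0 hT] := hf d d0.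
exists (size T) => M z TM hz.
rewrite -T0 -(sum_root_horner hz TM) -sumrB; apply: (le_trans (cmod_sum _ _ _)).
have -> : M%:R * d = \sum_(m < M) d by rewrite sumr_const card_ord mulr_natl.
by apply: ler_sum => m _; apply: hT; exact: (prim_root_cmod _ hz).
Qed.

(* Below, [w] on the unit circle parametrizes the circle of centre and radius
   [sg] by [z = sg (1 + w)]. *)
Lemma circle_neq (R : realType) (sg mu : R) (w : R[i]) :
  0 < mu < 2 * sg -> cmod w = 1 -> sg%:C * (1 + w) - mu%:C != 0.
Proof.
move=> /andP[mu0 mu1] w1; have sg0 : 0 < sg by lra.
apply/eqP => /eqP; rewrite subr_eq0 => /eqP E.
have : cmod (sg%:C * w) = cmod (mu - sg)%:C.
  by congr cmod; rewrite rmorphB /= -E; ring.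
rewrite cmodM w1 mulr1 !cmod_real gtr0_norm// => E'.
have : `|mu - sg| < sg by rewrite ltr_norml; lra.
by rewrite -E' ltxx.
Qed.

(** In the variable w the pole sits at (mu - sg) / sg, inside the unit disc. *)
Lemma circle_mean_shift_pole (R : realType) (sg mu : R) :
  0 < mu < 2 * sg -> circle_mean (fun w => (sg%:C * (1 + w) - mu%:C)^-1) 0.
Proof.
move=> /andP[mu0 mu1]; have sg0 : 0 < sg by lra.
have H : cmod ((mu - sg) / sg)%:C < 1.
  rewrite cmod_real normrM normfV (gtr0_norm sg0) ltr_pdivrMr// mul1r.
  by rewrite ltr_norml; lra.
have := circle_meanM (circle_mean_cst (sg%:C)^-1) (circle_mean_pole H).
rewrite mulr0; apply: circle_mean_ext => w w1.
have sgn : sg%:C != 0 :> R[i] by rewrite fmorph_eq0 gt_eqF.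
rewrite rmorphM /= fmorphV /= rmorphB /=.
rewrite -invfM; congr (_^-1); field; exact: sgn.
Qed.

(** For z != mu this is (z + mu) / (z - mu), split into its constant and polar parts so that circle
    means can be read off. *)
Definition blaschke_factor (R : realType) (mu : R) (z : R[i]) : R[i] :=
  1 + (2 * mu)%:C / (z - mu%:C).

(** These are the leading coefficients at infinity, B = 1 + 2 (sum of the mu_i) / z + ... . A new
    factor b contributes z (b - 1) B with z (b - 1) = 2 mu + 2 mu^2 / (z - mu). *)
Lemma circle_mean_blaschke (R : realType) (I : Type) (s : seq I) (P : pred I)
    (mu : I -> R) (sg : R) :
  (forall i, 0 < mu i < 2 * sg) ->
  let B w := \prod_(i <- s | P i) blaschke_factor (mu i) (sg%:C * (1 + w)) in
  circle_mean B 1 /\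
  circle_mean (fun w => sg%:C * (1 + w) * (B w - 1))
    (\sum_(i <- s | P i) 2 * mu i)%:C.
Proof.
move=> hmu; elim: s => [|i s [IH1 IH2]] /=.
  split; first by apply: circle_mean_ext (circle_mean_cst 1) => w _; rewrite big_nil.
  rewrite big_nil; apply: circle_mean_ext (circle_mean_cst 0) => w _.
  by rewrite big_nil subrr mulr0.
case: (boolP (P i)) => Pi; last first.
  split.
    by apply: circle_mean_ext IH1 => w _; rewrite big_cons (negbTE Pi).
  rewrite big_cons (negbTE Pi); apply: circle_mean_ext IH2 => w _.
  by rewrite big_cons (negbTE Pi).
have Hb : circle_mean (fun w => blaschke_factor (mu i) (sg%:C * (1 + w))) 1.
  have := circle_meanD (circle_mean_cst 1)
    (circle_meanM (circle_mean_cst (2 * mu i)%:C) (circle_mean_shift_pole (hmu i))).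
  by rewrite mulr0 addr0.
split.
  have := circle_meanM Hb IH1; rewrite mulr1; apply: circle_mean_ext => w _.
  by rewrite big_cons Pi.
have Hc : circle_mean (fun w => (2 * mu i)%:C +
    (2 * mu i * mu i)%:C / (sg%:C * (1 + w) - (mu i)%:C)) (2 * mu i)%:C.
  have := circle_meanD (circle_mean_cst (2 * mu i)%:C)
   (circle_meanM (circle_mean_cst (2 * mu i * mu i)%:C) (circle_mean_shift_pole (hmu i))).
  by rewrite mulr0 addr0.
have := circle_meanD (circle_meanM Hc IH1) IH2.
rewrite mulr1 -rmorphD /= big_cons Pi; apply: circle_mean_ext => w w1.
rewrite big_cons Pi /blaschke_factor; have := circle_neq (hmu i) w1.
move: (sg%:C * (1 + w)) => z zn; rewrite !rmorphM /= rmorph_nat.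
by field.
Qed.

(** The j-th Blaschke factor cancels 1 / (z + mu_j), leaving z^2 B_j / (z - mu_j), where B_j omits
    that factor and z^2 / (z - mu_j) = z + mu_j + mu_j^2 / (z - mu_j). The only positive power of w
    is then sg w, which is subtracted. *)
Lemma circle_mean_kernel (R : realType) (r : nat) (mu : 'I_r -> R) (sg : R) (j : 'I_r) :
  (forall i, 0 < mu i < 2 * sg) ->
  let z w : R[i] := sg%:C * (1 + w) in
  circle_mean (fun w => z w ^+ 2 * \prod_i blaschke_factor (mu i) (z w) /
      (z w + (mu j)%:C) - sg%:C * w)
    (sg + 2 * (\sum_i mu i) - mu j)%:C.
Proof.
move=> hmu z.
have [H1 H2] := circle_mean_blaschke (index_enum 'I_r) (fun i => i != j) hmu.
have Hc : circle_mean (fun w => (mu j)%:C + (mu j ^+ 2)%:C / (z w - (mu j)%:C)) (mu j)%:C.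
  have := circle_meanD (circle_mean_cst (mu j)%:C)
    (circle_meanM (circle_mean_cst (mu j ^+ 2)%:C) (circle_mean_shift_pole (hmu j))).
  by rewrite mulr0 addr0.
have := circle_meanD (circle_mean_cst sg%:C) (circle_meanD H2 (circle_meanM Hc H1)).
rewrite mulr1 -!rmorphD /= -mulr_sumr.
have -> : sg + (2 * (\sum_(i < r | i != j) mu i) + mu j) =
  sg + 2 * (\sum_i mu i) - mu j by rewrite [in RHS](bigD1 j) //=; ring.
apply: circle_mean_ext => w w1; rewrite [X in _ * X / _](bigD1 j) //=.
have zn : z w - (mu j)%:C != 0 := circle_neq (hmu j) w1.
have zp : z w + (mu j)%:C != 0.
  apply/eqP => /eqP; rewrite addr_eq0 => /eqP E.
  have /andP[mu0 mu1] := hmu j; have sg0 : 0 < sg by lra.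
  have : cmod (sg%:C * w) = cmod (- (mu j + sg))%:C.
    by congr cmod; rewrite rmorphN rmorphD /= opprD -E /z; ring.
  rewrite cmodM w1 mulr1 !cmod_real normrN !gtr0_norm ?addr_gt0//; lra.
have zE : sg%:C * w = z w - sg%:C by rewrite /z; ring.
rewrite zE -/(z w); set B := \prod_(i < r | i != j) _.
rewrite /blaschke_factor rmorphXn /= rmorphM /= rmorph_nat.
by field; rewrite zn zp.
Qed.

(** * Newman's inequality *)

Lemma laplace_bound (R : realType) (r : nat) (mu c : 'I_r -> R) (z : R[i]) (W : R) :
  0 < complex.Re z -> (forall j, 0 < mu j) ->
  (forall t : R, 0 <= t -> `|expsum (fun j => - mu j) c t| <= W) ->
  cmod (\sum_(j < r) (c j)%:C / (z + (mu j)%:C)) <= W / complex.Re z.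
Proof.
move=> x0 mu0 hW; set S := \sum_(j < r) _.
have W0 : 0 <= W by apply: le_trans (hW 0 (lexx _)).
have [S0|Sn] := eqVneq (cmod S) 0.
  by rewrite S0 divr_ge0// ltW.
have Sp : 0 < cmod S by rewrite lt_neqAle eq_sym Sn cmod_ge0.
(* This unimodular phase rotates S onto the positive real axis, where [laplace_bound_real]
   applies. *)
pose u : R[i] := conjc S / (cmod S)%:C.
pose d j := u * ((c j)%:C / (z + (mu j)%:C)).
have uS : u * S = (cmod S)%:C.
  have Sn' : (cmod S)%:C != 0 :> R[i] by rewrite fmorph_eq0.
  have -> : u * S = (S * conjc S) / (cmod S)%:C by rewrite /u mulrAC [S * _]mulrC.
  rewrite -sqr_normc.
  have -> : `|S| = (cmod S)%:C by [].
  by rewrite expr2 mulfK.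
have dz j : d j * (z + (mu j)%:C) = u * (c j)%:C.
  rewrite /d -mulrA divfK//; apply/eqP => /(congr1 (@complex.Re R)) /=.
  case: (z) x0 => x y /= x0 /eqP; rewrite gt_eqF// addr_gt0//.
have -> : cmod S = \sum_(j < r) complex.Re (d j).
  have -> : cmod S = complex.Re (u * S) by rewrite uS.
  by rewrite mulr_sumr raddf_sum.
have u1 : complex.Re u ^+ 2 + complex.Im u ^+ 2 <= 1.
  rewrite -cmod_sqr /u cmodM cmodV cmod_real (gtr0_norm Sp).
  have -> : cmod (conjc S) = cmod S by case: (S) => a b; rewrite /cmod /= sqrrN.
  by rewrite divff ?expr1n.
apply: (@laplace_bound_real _ _ mu c (fun j => complex.Re (d j))
  (fun j => complex.Im (d j)) _ (complex.Im z) (complex.Re u) (complex.Im u)) => // j.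
- exact: ltW.
- have /(congr1 (@complex.Re R)) := dz j.
  case: (d j) (z) (u) => a b [x y] [e f] /= E; lra.
- have /(congr1 (@complex.Im R)) := dz j.
  case: (d j) (z) (u) => a b [x y] [e f] /= E; lra.
Qed.

(** With k = mu / sg <= 1/2 and 1 + 4k <= e^(4k), it suffices that |z + mu|^2 <= (1 + 4k) |z -
    mu|^2. On the circle, with p = Re w, the difference is sg^2 (4k (1 + p) (1 - 2k) + 4k^3) >=
    0. *)
Lemma blaschke_bound (R : realType) (sg mu : R) (w : R[i]) :
  0 < mu <= sg / 2 -> cmod w = 1 ->
  cmod (blaschke_factor mu (sg%:C * (1 + w))) ^+ 2 <= expR (4 * mu / sg).
Proof.
move=> /andP[mu0 mus] w1; have sg0 : 0 < sg by lra.
have zn : sg%:C * (1 + w) - mu%:C != 0 by apply: circle_neq => //; rewrite mu0; lra.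
apply: le_trans (expR_ge1Dx _).
have -> : blaschke_factor mu (sg%:C * (1 + w)) =
    (sg%:C * (1 + w) + mu%:C) / (sg%:C * (1 + w) - mu%:C).
  by rewrite /blaschke_factor rmorphM rmorph_nat; field.
rewrite cmodM cmodV expr_div_n ler_pdivrMr; last first.
  rewrite exprn_gt0// lt_neqAle cmod_ge0 andbT eq_sym.
  by apply: contraNneq zn => /cmod_eq0 ->.
rewrite !cmod_sqr; have := cmod_sqr w; rewrite w1 expr1n.
case: w w1 zn => p q /= _ _ E.
have p1 : -1 <= p <= 1 by rewrite -ler_norml -[leRHS]ger0_norm// -ler_sqr ?nnegrE// !real_normK ?num_real// expr1n; have := sqr_ge0 q; lra.
pose k := mu / sg; have k0 : 0 < k by rewrite divr_gt0.
have k1 : k <= 1 / 2 by rewrite ler_pdivrMr//; lra.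
have -> : mu = k * sg by rewrite /k divfK// gt_eqF.
clearbody k.
have -> : 4 * (k * sg) / sg = 4 * k by field; rewrite gt_eqF.
rewrite -subr_ge0.
have -> : (1 + 4 * k) * ((sg * (1 + p) - 0 * (0 + q) - k * sg) ^+ 2 +
    (sg * (0 + q) + 0 * (1 + p) - 0) ^+ 2) -
  ((sg * (1 + p) - 0 * (0 + q) + k * sg) ^+ 2 +
    (sg * (0 + q) + 0 * (1 + p) + 0) ^+ 2) =
  sg ^+ 2 * (4 * k * ((1 + p) * (1 - 2 * k)) + 4 * k ^+ 3).
  have q2 : q ^+ 2 = 1 - p ^+ 2 by rewrite E; ring.
  transitivity (sg ^+ 2 * ((1 + 4 * k) * ((1 + p - k) ^+ 2 + q ^+ 2) -
    ((1 + p + k) ^+ 2 + q ^+ 2))); first by ring.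
  by rewrite q2; ring.
rewrite mulr_ge0 ?sqr_ge0// addr_ge0//; last by rewrite mulr_ge0// exprn_ge0// ltW.
by case/andP: p1 => p1 p2; rewrite !mulr_ge0//; lra.
Qed.

Lemma blaschke_prod_bound (R : realType) (r : nat) (mu : 'I_r -> R) (sg : R) (w : R[i]) :
  (forall j, 0 < mu j) -> 0 < sg -> 2 * (\sum_j mu j) <= sg -> cmod w = 1 ->
  cmod (\prod_j blaschke_factor (mu j) (sg%:C * (1 + w))) <= expR 1.
Proof.
move=> mu0 sg0 musg w1.
rewrite -ler_sqr ?nnegrE ?cmod_ge0 ?expR_ge0// cmod_prod -prodrXl.
have muj j : mu j <= sg / 2.
  rewrite ler_pdivlMr// mulrC; apply: le_trans musg; rewrite ler_wpM2l//.
  by rewrite (bigD1 j) //= lerDl sumr_ge0// => i _; exact: ltW.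
apply: (@le_trans _ _ (\prod_j expR (4 * mu j / sg))).
  apply: ler_prod => j _; rewrite exprn_ge0 ?cmod_ge0//=.
  by apply: blaschke_bound => //; rewrite mu0 muj.
rewrite -expR_sum -expRM_natl ler_expR -mulr_suml -mulr_sumr mulr1.
by rewrite ler_pdivrMr// (_ : 4 = 2 * 2) -?mulrA ?ler_wpM2l//; ring.
Qed.

(** On the circle |z|^2 = 2 sg Re z, and this factor cancels the 1 / Re z of [laplace_bound]. Where
    Re z <= 0 one has z = 0. *)
Lemma newman_avg (R : realType) (r : nat) (mu c : 'I_r -> R) (sg W : R) (w z : R[i]) :
  (forall j, 0 < mu j) ->
  (forall t : R, 0 <= t -> `|expsum (fun j => - mu j) c t| <= W) ->
  2 * (\sum_j mu j) <= sg -> 0 < sg -> cmod w = 1 -> z = sg%:C * (1 + w) ->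
  cmod (z ^+ 2 * (\prod_j blaschke_factor (mu j) z) *
    \sum_j (c j)%:C / (z + (mu j)%:C)) <= 2 * sg * expR 1 * W.
Proof.
move=> mu0 hW musg sg0 w1 zE.
have W0 : 0 <= W by apply: le_trans (hW 0 (lexx _)).
have z2 : cmod z ^+ 2 = 2 * sg * complex.Re z.
  rewrite cmod_sqr zE; have := cmod_sqr w; rewrite w1 expr1n.
  case: (w) => p q /= E; have q2 : q ^+ 2 = 1 - p ^+ 2 by rewrite E; ring.
  transitivity (sg ^+ 2 * ((1 + p) ^+ 2 + q ^+ 2)); first by ring.
  by rewrite q2; ring.
have B := blaschke_prod_bound mu0 sg0 musg w1; rewrite -zE in B.
have C0 : 0 <= 2 * sg * expR 1 * W by rewrite !mulr_ge0 ?expR_ge0// ltW.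
have [x0|] := ltP 0 (complex.Re z); last first.
  move=> x0; have z0 : z = 0.
    apply: cmod_eq0; apply/eqP; rewrite -sqrf_eq0 eq_le sqr_ge0 andbT z2.
    by rewrite mulr_ge0_le0// mulr_ge0// ltW.
  by rewrite z0 expr0n /= !mul0r cmod0.
rewrite cmodM cmodM cmodX z2 -!mulrA.
have L := laplace_bound x0 mu0 hW.
apply: (@le_trans _ _ (2 * (sg * (complex.Re z * (expR 1 * (W / complex.Re z)))))).
  rewrite !ler_wpM2l ?(ltW sg0) ?(ltW x0)//.
  by apply: ler_pM; rewrite ?cmod_ge0.
rewrite !ler_wpM2l ?(ltW sg0)//.
have -> : complex.Re z * (expR 1 * (W / complex.Re z)) = expR 1 * W => //.
by field; rewrite gt_eqF.
Qed.

(* The average over the circle of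
   [z^2 B(z) \sum_j c_j / (z + mu_j)], with [B] the Blaschke product, is both
   small by [newman_avg] and, by [circle_mean_kernel], equal to
   [\sum_j c_j (4 S - mu_j)]. *)
Lemma newman (R : realType) (r : nat) (mu c : 'I_r -> R) (W : R) :
  (0 < r)%N -> (forall j, 0 < mu j) ->
  (forall t : R, 0 <= t -> `|expsum (fun j => - mu j) c t| <= W) ->
  `|\sum_j c j * mu j| <= (4 + 4 * expR 1) * (\sum_j mu j) * W.
Proof.
move=> r0 mu0 hW; set S := \sum_j mu j; pose sg := 2 * S.
have W0 : 0 <= W by apply: le_trans (hW 0 (lexx _)).
have muS j : mu j <= S.
  by rewrite /S (bigD1 j) //= lerDl sumr_ge0// => i _; exact: ltW.
have S0 : 0 < S by apply: lt_le_trans (muS (Ordinal r0)).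
have sg0 : 0 < sg by rewrite mulr_gt0.
have musg j : 0 < mu j < 2 * sg.
  by rewrite mu0 /sg; have := muS j; have := mu0 j; lra.
have main : cmod (\sum_j (c j)%:C * (sg + 2 * S - mu j)%:C) <= 2 * sg * expR 1 * W.
  apply/ler_addgt0Pr => e e0.
  pose K : R := \sum_j `|c j| + 1; have K0 : 0 < K by rewrite ltr_wpDl// sumr_ge0.
  have eK : 0 < e / K by rewrite divr_gt0.
  have [f hf] := fin_all_exists
    (fun j => circle_mean_avg (circle_mean_kernel j musg) eK).
  (* M exceeds every averaging threshold, and M >= 2 makes the M-th roots of unity sum to zero,
     which removes the term sg w left out of the kernel. *)
  pose M := (\max_j f j + 2)%N; have M0 : (0 < M)%N by rewrite /M; lia.
  have [z hz] := prim_root_complex R M0.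
  have MR : 0 < M%:R :> R by rewrite ltr0n.
  have z0 : \sum_(m < M) z ^+ m = 0.
    have := sum_unity_root_pow (k := 1) (prim_expr_order hz).
    rewrite expr1 -{1}[z]expr1 -(prim_order_dvd hz) gtnNdvd ?/M; last by lia.
      by move=> /(_ isT) H; rewrite -[RHS]H; apply: eq_bigr => m _; rewrite expr1.
    by lia.
  pose w m := z ^+ m; pose Z m := sg%:C * (1 + w m) : R[i].
  pose T m := Z m ^+ 2 * (\prod_i blaschke_factor (mu i) (Z m)) *
    \sum_j (c j)%:C / (Z m + (mu j)%:C).
  have hT : cmod (\sum_(m < M) T m) <= M%:R * (2 * sg * expR 1 * W).
    apply: (le_trans (cmod_sum _ _ _)).
    rewrite mulr_natl -[X in _ *+ X]card_ord -sumr_const; apply: ler_sum => m _.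
    apply: (newman_avg (w := w m)) => //; exact: (prim_root_cmod _ hz).
  pose D j := \sum_(m < M) (Z m ^+ 2 * (\prod_i blaschke_factor (mu i) (Z m)) /
    (Z m + (mu j)%:C) - sg%:C * z ^+ m) - M%:R * (sg + 2 * S - mu j)%:C.
  have hD j : cmod (D j) <= M%:R * (e / K).
    by apply: hf => //; rewrite /M (leq_trans (leq_bigmax j))// leq_addr.
  have E : M%:R * (\sum_j (c j)%:C * (sg + 2 * S - mu j)%:C) =
      \sum_(m < M) T m - \sum_j (c j)%:C * D j.
    rewrite mulr_sumr; apply/eqP; rewrite eq_sym subr_eq -big_split /=; apply/eqP.
    rewrite /T; under eq_bigr do rewrite mulr_sumr.
    rewrite exchange_big /=; apply: eq_bigr => j _.
    rewrite /D sumrB -mulr_sumr z0 mulr0 subr0 mulrBr addrCA.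
    rewrite [X in _ = _ + (_ - X)]mulrCA subrr addr0 mulr_sumr.
    by apply: eq_bigr => m _; ring.
  rewrite -(ler_pM2l MR) -{1}[M%:R]ger0_norm ?ler0n// -cmod_real rmorph_nat -cmodM E.
  apply: (le_trans (cmodB _ _)); rewrite mulrDr; apply: lerD => //.
  apply: (le_trans (cmod_sum _ _ _)).
  apply: (@le_trans _ _ (\sum_j `|c j| * (M%:R * (e / K)))).
    by apply: ler_sum => j _; rewrite cmodM cmod_real ler_wpM2l.
  rewrite -mulr_suml mulrCA ler_wpM2l ?ler0n// mulrA ler_pdivrMr// mulrC ler_wpM2l ?(ltW e0)//.
  by rewrite /K lerDl.
have c0 : `|\sum_j c j| <= W.
  have := hW 0 (lexx _); congr (`|_| <= _); apply: eq_bigr => j _.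
  by rewrite mulr0 expR0 mulr1.
have E : \sum_j (c j)%:C * (sg + 2 * S - mu j)%:C =
    (4 * S * (\sum_j c j) - \sum_j c j * mu j)%:C :> R[i].
  rewrite [in RHS]mulr_sumr -sumrB rmorph_sum /=; apply: eq_bigr => j _.
  by rewrite -rmorphM /=; congr (_%:C); rewrite /sg; ring.
rewrite E cmod_real in main.
(* The first sum is 4 S p(0) with |p(0)| <= W, the second is bounded by [main]. *)
have -> : \sum_j c j * mu j = 4 * S * (\sum_j c j) -
  (4 * S * (\sum_j c j) - \sum_j c j * mu j) by ring.
apply: (le_trans (ler_normB _ _)).
have -> : (4 + 4 * expR 1) * S * W = 4 * S * W + 2 * sg * expR 1 * W by rewrite /sg; ring.
apply: lerD main; rewrite normrM ger0_norm; first by rewrite ler_wpM2l// mulr_ge0// ltW.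
by rewrite mulr_ge0// ltW.
Qed.

(** * The Bernstein inequality in the sup norm *)

Lemma expsum0 (R : realType) (r : nat) (lam c : 'I_r -> R) :
  expsum lam c 0 = \sum_j c j.
Proof. by apply: eq_bigr => j _; rewrite mulr0 expR0 mulr1. Qed.

Lemma expsum_shift (R : realType) (r : nat) (lam c : 'I_r -> R) (t s : R) :
  expsum lam c (t + s) = expsum lam (fun j => c j * expR (lam j * t)) s.
Proof. by apply: eq_bigr => j _; rewrite mulrDr expRD mulrA. Qed.

Lemma expsum_damp (R : realType) (r : nat) (lam c : 'I_r -> R) (A s : R) :
  expsum (fun j => lam j - A) c s = expR (- A * s) * expsum lam c s.
Proof.
by rewrite mulr_sumr; apply: eq_bigr => j _; rewrite mulrBl -mulNr expRD; ring.
Qed.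

(** D is any a priori bound on the derivative; its share D / 4 is the price of removing the large
    exponents and is absorbed in [bernstein_interval]. *)
Lemma bernstein_endpoint (R : realType) (r : nat) (lam c : 'I_r -> R) (L W D : R) :
  (0 < r)%N -> 0 < L ->
  (forall t : R, 0 <= t <= L -> `|expsum lam c t| <= W) ->
  (forall t : R, 0 <= t <= L -> `|expsum lam (fun j => c j * lam j) t| <= D) ->
  `|expsum lam (fun j => c j * lam j) 0| <=
    5 / 4 * (5 + 4 * expR 1) * (28 * r%:R ^+ 2 / L + \sum_j `|lam j|) * W + D / 4.
Proof.
move=> r0 L0 hW hD; have rR : 1 <= r%:R :> R by rewrite ler1n.
have W0 : 0 <= W by apply: le_trans (hW 0 _); rewrite // lexx/= ltW.
have [e he hcorr] := expsum_remove_large lam r0 L0.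
(* A1 is the removal threshold; A2 is the growth rate allowed by [expsum_ext_bound] on an interval
   of length L / 2. *)
pose A1 := 24 * r%:R / L; pose A2 := 4 * r%:R / L; pose A := A1 + A2.
have A20 : 0 < A2 by rewrite divr_gt0// mulr_gt0//; lra.
have A10 : 0 < A1 by rewrite divr_gt0// mulr_gt0//; lra.
(* Removed exponents are reset to 0: their coefficients c_j e_j vanish, and every mu_j becomes
   positive with |lam'_j| <= |lam_j|. *)
pose lam' j := if lam j < A1 then lam j else 0.
have lam'A j : lam' j <= A1 by rewrite /lam'; case: ltP => // h; exact: ltW.
have lam'n j : `|lam' j| <= `|lam j| by rewrite /lam'; case: ifP; rewrite ?normr0.
pose c1 j := c j * e j.
pose mu j := A - lam' j.
have mu0 j : 0 < mu j by rewrite /mu /A; have := lam'A j; move: A20; lra.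
have p1E s : expsum lam c1 s = expsum lam' c1 s.
  apply: eq_bigr => j _; rewrite /lam'; case: ltP => // h.
  by rewrite /c1 he// mulr0 !mul0r.
have psplit (d : 'I_r -> R) s : expsum lam d s =
    expsum lam (fun j => d j * e j) s + expsum lam (fun j => d j * (1 - e j)) s.
  by rewrite /expsum -big_split /=; apply: eq_bigr => j _; ring.
have p1W (s : R) : 0 <= s <= L / 2 -> `|expsum lam' c1 s| <= 5 / 4 * W.
  move=> /andP[s0 sL]; rewrite -p1E.
  have -> : expsum lam c1 s = expsum lam c s - expsum lam (fun j => c j * (1 - e j)) s.
    by rewrite (psplit c s) addrK.
  apply: (le_trans (ler_normB _ _)).
  have -> : 5 / 4 * W = W + 4^-1 * W by field.
  apply: lerD; first by apply: hW; rewrite s0 (le_trans sL)//; lra.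
  apply: hcorr => t /andP[st tL]; apply: hW; rewrite (le_trans s0 st) (le_trans tL)//.
  by move: sL; lra.
(* Damping by A1 makes all exponents nonpositive, so the sum extends from [0, L / 2] with growth
   e^(A2 s); the further damping by A2 cancels this growth. *)
have pmuW (s : R) : 0 <= s -> `|expsum (fun j => - mu j) c1 s| <= 5 / 4 * W.
  move=> s0.
  have -> : (fun j => - mu j) = (fun j => (lam' j - A1) - A2).
    by apply/funext => j; rewrite /mu /A; ring.
  rewrite expsum_damp normrM ger0_norm ?expR_ge0//.
  have H := @expsum_ext_bound _ _ (fun j => lam' j - A1) c1 (L / 2) (5 / 4 * W) s r0.
  apply: (@le_trans _ _ (expR (- A2 * s) * (5 / 4 * W * expR (2 * (s * r%:R / (L / 2)))))).
    rewrite ler_wpM2l ?expR_ge0//; apply: H => //.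
    - by rewrite divr_gt0.
    - by move=> j; rewrite subr_le0.
    - move=> t t0; rewrite expsum_damp normrM -[leRHS]mul1r.
      apply: ler_pM => //; last exact: p1W.
      rewrite ger0_norm ?expR_ge0// -expR0 ler_expR mulNr oppr_le0 mulr_ge0 ?(ltW A10)//.
      by case/andP: t0.
  rewrite mulrCA -expRD (_ : - A2 * s + _ = 0) ?expR0 ?mulr1//.
  by rewrite /A2; field; rewrite gt_eqF.
have N := newman r0 mu0 pmuW.
rewrite (psplit (fun j => c j * lam j)); apply: (le_trans (ler_normD _ _)).
apply: lerD; last first.
  rewrite [leRHS]mulrC; apply: hcorr => s /andP[s0 sL]; apply: hD.
  by rewrite s0 (le_trans sL)// add0r; lra.
have -> : expsum lam (fun j => c j * lam j * e j) 0 =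
    A * (\sum_j c1 j) - \sum_j c1 j * mu j.
  rewrite expsum0 mulr_sumr -sumrB; apply: eq_bigr => j _.
  rewrite /c1 /mu /lam'; case: ltP => h; first by ring.
  by rewrite he//; ring.
apply: (le_trans (ler_normB _ _)).
set G := 28 * _ / _ + _.
have AG : A <= G.
  apply: (@le_trans _ _ (28 * r%:R ^+ 2 / L)); last by rewrite lerDl sumr_ge0.
  rewrite /A /A1 /A2 -mulrDl ler_wpM2r ?invr_ge0 ?(ltW L0)//.
  rewrite -mulrDl (_ : 24 + 4 = 28); last by ring.
  by rewrite ler_wpM2l// expr2 ler_peMr//; lra.
have A0 : 0 < A by rewrite addr_gt0.
(* The r copies of A = 28 r / L produce the quadratic term of G. *)
have SG : \sum_j mu j <= G.
  rewrite /mu sumrB sumr_const card_ord /G -sumrN; apply: lerD.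
    rewrite -mulr_natr /A /A1 /A2; rewrite le_eqVlt; apply/orP; left; apply/eqP.
    by field; rewrite gt_eqF.
  apply: ler_sum => j _; apply: le_trans (lam'n j).
  by rewrite -normrN ler_norm.
have -> : 5 / 4 * (5 + 4 * expR 1) * G * W =
  G * (5 / 4 * W) + (4 + 4 * expR 1) * G * (5 / 4 * W) by field.
have W54 : 0 <= 5 / 4 * W by rewrite mulr_ge0.
have S0 : 0 <= \sum_j mu j by apply: sumr_ge0 => j _; exact: ltW.
apply: lerD.
  rewrite normrM ger0_norm ?(ltW A0)//; apply: ler_pM => //; first exact: ltW.
  rewrite -(expsum0 lam'); apply: p1W; rewrite lexx /=; move: L0; lra.
apply: (le_trans N); rewrite ler_wpM2r// ler_wpM2l// addr_ge0// mulr_ge0// expR_ge0.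
Qed.

(** Iterating D -> B + D / 2 from the finite bound D0 gives 2 B + 2^(-k) (D0 - 2 B) after k steps.
    This absorbs a share of a supremum without naming the supremum. *)
Lemma contract_bound (R : realType) (T : Type) (A : set T) (f : T -> R) (B D0 : R) :
  (forall t, A t -> `|f t| <= D0) ->
  (forall D, (forall t, A t -> `|f t| <= D) -> forall t, A t -> `|f t| <= B + D / 2) ->
  forall t, A t -> `|f t| <= 2 * B.
Proof.
move=> h0 hstep.
have H k t : A t -> `|f t| <= 2 * B + 2^-1 ^+ k * (D0 - 2 * B).
  elim: k t => [|k IH] t At; first by rewrite expr0 mul1r addrC subrK; exact: h0.
  apply: (le_trans (hstep _ IH _ At)); rewrite exprS le_eqVlt; apply/orP; left.
  by apply/eqP; field.
move=> t At; apply/ler_addgt0Pr => e e0.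
have [D1|D1] := leP (D0 - 2 * B) 0.
  apply: (le_trans (H 0%N t At)); rewrite expr0 mul1r lerD2l; exact: le_trans (ltW e0).
have [k hk] : exists k : nat, (2^-1 : R) ^+ k <= e / (D0 - 2 * B).
  by apply: exp_small; rewrite ?divr_gt0// invr_ge0 ler0n invf_lt1// ltr1n.
apply: (le_trans (H k t At)); rewrite lerD2l.
by rewrite -ler_pdivlMr.
Qed.

Lemma expsum_bounded (R : realType) (r : nat) (lam c : 'I_r -> R) (L : R) :
  exists B : R, forall t : R, 0 <= t <= L -> `|expsum lam c t| <= B.
Proof.
exists (\sum_j `|c j| * expR (`|lam j| * L)) => t /andP[t0 tL].
apply: (le_trans (ler_norm_sum _ _ _)); apply: ler_sum => j _.
rewrite normrM [`|expR _|]ger0_norm ?expR_ge0// ler_wpM2l// ler_expR.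
apply: (@le_trans _ _ (`|lam j| * t)); first by rewrite ler_wpM2r// ler_norm.
by rewrite ler_wpM2l.
Qed.

(** Each t is an endpoint of a subinterval of length L: [t, t + L] if t <= L, otherwise [t - L, t]
    after reflection, which changes the signs of the exponents but not the sum of their absolute
    values. *)
Lemma bernstein_interval (R : realType) (r : nat) (lam c : 'I_r -> R) (L W : R) :
  (0 < r)%N -> 0 < L ->
  (forall t : R, 0 <= t <= 2 * L -> `|expsum lam c t| <= W) ->
  forall t : R, 0 <= t <= 2 * L -> `|expsum lam (fun j => c j * lam j) t| <=
    2 * (5 / 4 * (5 + 4 * expR 1) * (28 * r%:R ^+ 2 / L + \sum_j `|lam j|) * W).
Proof.
move=> r0 L0 hW.
have [D0 hD0] := expsum_bounded lam (fun j => c j * lam j) (2 * L).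
apply: (@contract_bound R R (fun t => 0 <= t <= 2 * L) _ _ D0) => // D hD t /andP[t0 tL].
have Dp : 0 <= D by apply: le_trans (hD 0 _); rewrite // lexx/= mulr_ge0// ltW.
set K := 5 / 4 * _ * _; apply: (@le_trans _ _ (K * W + D / 4)); last first.
  by rewrite lerD2l; lra.
have [tl|tl] := leP t L.
  have E d : expsum lam d t = expsum lam (fun j => d j * expR (lam j * t)) 0.
    by rewrite -expsum_shift addr0.
  rewrite E.
  have -> : (fun j => c j * lam j * expR (lam j * t)) =
            (fun j => c j * expR (lam j * t) * lam j).
    by apply/funext => j; rewrite mulrAC.
  apply: bernstein_endpoint => // s /andP[s0 sL].
    by rewrite -expsum_shift; apply: hW; rewrite addr_ge0//=; lra.
  have -> : (fun j => c j * expR (lam j * t) * lam j) =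
            (fun j => c j * lam j * expR (lam j * t)).
    by apply/funext => j; rewrite mulrAC.
  by rewrite -expsum_shift; apply: hD; rewrite addr_ge0//=; lra.
have refl d s : expsum lam d (t - s) =
    expsum (fun j => - lam j) (fun j => d j * expR (lam j * t)) s.
  by apply: eq_bigr => j _; rewrite mulrBr expRD -mulNr; ring.
have E : expsum lam (fun j => c j * lam j) t = - expsum (fun j => - lam j)
    (fun j => c j * expR (lam j * t) * - lam j) 0.
  rewrite -[t in LHS]subr0 refl /expsum -sumrN; apply: eq_bigr => j _; ring.
rewrite E normrN /K.
have -> : \sum_j `|lam j| = \sum_j `|- lam j| by apply: eq_bigr => j _; rewrite normrN.
apply: bernstein_endpoint => // s /andP[s0 sL].
  by rewrite -refl; apply: hW; apply/andP; split; lra.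
have -> : expsum (fun j => - lam j) (fun j => c j * expR (lam j * t) * - lam j) s =
    - expsum lam (fun j => c j * lam j) (t - s).
  by rewrite refl /expsum -sumrN; apply: eq_bigr => j _; ring.
by rewrite normrN; apply: hD; apply/andP; split; lra.
Qed.

(** * Quadrature for the derivative *)

(** Discretization for the duality argument: on a grid fine enough, uniformly in c, the Bernstein
    inequality itself shows that the maximum over [0, L] is at most twice the maximum over the
    grid. *)
Lemma bernstein_grid (R : realType) (r : nat) (lam : 'I_r -> R) (L : R) :
  (0 < r)%N -> 0 < L ->
  exists M : nat, forall (c : 'I_r -> R) (m : R),
    (forall i : nat, (i <= M)%N -> `|expsum lam c (i%:R * (L / M%:R))| <= m) ->
    `|\sum_j c j * lam j| <=
      5 * (5 + 4 * expR 1) * (56 * r%:R ^+ 2 / L + \sum_j `|lam j|) * m.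
Proof.
move=> r0 L0; set G := 56 * _ / _ + _; set k := 5 + 4 * expR 1.
have k0 : 0 < k by rewrite addr_gt0// mulr_gt0// expR_gt0.
have rR : 1 <= r%:R :> R by rewrite ler1n.
have G0 : 0 < G.
  rewrite ltr_wpDr ?sumr_ge0// divr_gt0// mulr_gt0// exprn_gt0//; lra.
pose K := 5 / 2 * k * G; have K0 : 0 < K by rewrite !mulr_gt0.
have bern c W : (forall t : R, 0 <= t <= L -> `|expsum lam c t| <= W) ->
    forall t : R, 0 <= t <= L -> `|expsum lam (fun j => c j * lam j) t| <= K * W.
  move=> hW t tL; have L2 : 2 * (L / 2) = L by field.
  have := @bernstein_interval _ _ lam c (L / 2) W r0 _ _ t.
  rewrite L2 => /(_ (divr_gt0 L0 (ltr0Sn _ _)) hW tL).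
  have -> : 28 * r%:R ^+ 2 / (L / 2) = 56 * r%:R ^+ 2 / L.
    by field; rewrite gt_eqF.
  by rewrite -/G -/k; have -> : 2 * (5 / 4 * k * G * W) = K * W by rewrite /K; field.
(* Then the mesh h = L / M satisfies h K <= 1/2, so moving from a grid point to t changes the sum by
   at most W / 2. *)
pose M := (Num.truncn (2 * L * K)).+1; exists M => c m hm.
have MR : 0 < M%:R :> R by rewrite ltr0n.
have hM : 2 * L * K <= M%:R.
  apply: ltW; have /andP[] : (Num.truncn (2 * L * K))%:R <= 2 * L * K < M%:R => //.
  by apply: truncn_itv; rewrite !mulr_ge0// ltW.
pose h := L / M%:R; have h0 : 0 < h by rewrite divr_gt0.
have Mh : M%:R * h = L by rewrite /h mulrCA divff ?mulr1// gt_eqF.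
have hK : h * K <= 1 / 2.
  by rewrite /h mulrAC ler_pdivrMr// mulrAC; move: hM; lra.
have [W0 hW0] := expsum_bounded lam c L.
have {W0 hW0}two t : 0 <= t <= L -> `|expsum lam c t| <= 2 * m.
  move: t; apply: (@contract_bound R R (fun t => 0 <= t <= L) _ _ W0) => //.
  move=> W hW t /andP[t0 tL].
  pose i := Num.truncn (t / h).
  have /andP[i1 i2] : i%:R <= t / h < i.+1%:R.
    by apply: truncn_itv; rewrite divr_ge0// ltW.
  rewrite ler_pdivlMr// in i1; rewrite ltr_pdivrMr// in i2.
  have iM : (i <= M)%N.
    by rewrite -(ler_nat R) -(ler_pM2r h0) Mh (le_trans i1).
  have [x xit E] : exists2 x, x \in `[i%:R * h, t]%R & expsum lam c t - expsum lam c (i%:R * h) =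
      expsum lam (fun j => c j * lam j) x * (t - i%:R * h).
    apply: MVT_segment => // [x _|]; first exact: is_derive_expsum.
    apply: derivable_within_continuous => x _.
    by have [] := is_derive_expsum lam c x.
  have -> : expsum lam c t = expsum lam c (i%:R * h) +
      (expsum lam c t - expsum lam c (i%:R * h)) by ring.
  apply: (le_trans (ler_normD _ _)); apply: lerD; first exact: hm.
  have W0' : 0 <= W by apply: le_trans (hW 0 _); rewrite // lexx/= ltW.
  rewrite E normrM; move: xit; rewrite in_itv /= => /andP[x1 x2].
  apply: (@le_trans _ _ (K * W * h)).
    apply: ler_pM => //.
      apply: bern => //; rewrite (le_trans x2)// andbT (le_trans _ x1)//.
      by rewrite mulr_ge0// ltW.
    rewrite ger0_norm ?subr_ge0// lerBlDr addrC.
    by rewrite -[X in _ + X]mul1r -mulrDl natr1 ltW.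
  by rewrite mulrAC [K * h]mulrC mulrC; have := ler_wpM2l W0' hK; lra.
have := bern c (2 * m) two 0; rewrite lexx ltW// expsum0 => /(_ isT).
by have -> : K * (2 * m) = 5 * k * G * m by rewrite /K; field.
Qed.

(* Extends [phi] from the exponential sums to one more grid point at a time;
   [d] is a free vector of values on the first [k] grid points. *)
Lemma norming_weights_step (R : realType) (r M : nat) (v : ('I_r -> R) -> nat -> R)
    (phi : ('I_r -> R) -> R) (C : R) (k : nat) :
  (forall c c' i, v (fun j => c j + c' j) i = v c i + v c' i) ->
  (forall a c i, v (fun j => a * c j) i = a * v c i) ->
  (forall c c', phi (fun j => c j + c' j) = phi c + phi c') ->
  (forall a c, phi (fun j => a * c j) = a * phi c) ->
  (forall c m, (forall i, (i <= M)%N -> `|v c i| <= m) -> phi c <= C * m) ->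
  exists w : nat -> R, forall c (d : nat -> R) m,
    (forall i, (k <= i)%N -> d i = 0) ->
    (forall i, (i <= M)%N -> `|v c i + d i| <= m) ->
    phi c + \sum_(i < k) w i * d i <= C * m.
Proof.
move=> vD vZ pD pZ hC; elim: k => [|k [w IH]].
  exists (fun=> 0) => c d m hd hm; rewrite big_ord0 addr0; apply: hC => i iM.
  by have := hm i iM; rewrite hd// addr0.
pose good c (d : nat -> R) m := (forall i, (k < i)%N -> d i = 0) /\
  (forall i, (i <= M)%N -> `|v c i + d i| <= m).
pose Fv c (d : nat -> R) := phi c + \sum_(i < k) w i * d i.
(* One step of Hahn-Banach: adding the two vectors cancels coordinate k, so the induction hypothesis
   puts every lower bound for the new weight below every upper bound. *)
have key c d m c' d' m' : good c d m -> good c' d' m' -> d k = 1 -> d' k = -1 ->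
    Fv c' d' - C * m' <= C * m - Fv c d.
  move=> [g1 g2] [g1' g2'] dk dk'.
  have H := IH (fun j => c j + c' j) (fun i => d i + d' i) (m + m').
  have : phi (fun j => c j + c' j) + \sum_(i < k) w i * (d i + d' i) <= C * (m + m').
    apply: H => i ik.
      move: ik; rewrite leq_eqVlt => /predU1P[<-|ik]; first by rewrite dk dk' subrr.
      by rewrite g1// g1'// addr0.
    rewrite vD addrACA; apply: (le_trans (ler_normD _ _)).
    by apply: lerD; [exact: g2|exact: g2'].
  rewrite pD; under eq_bigr do rewrite mulrDr.
  rewrite big_split /= mulrDr /Fv; lra.
pose S := [set x | exists c d m, [/\ good c d m, d k = -1 & x = Fv c d - C * m]].
pose e1 (s : R) i : R := if i == k then s else 0.
have v0 i : v (fun=> 0) i = 0.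
  by have := vZ 0 (fun=> 0) i; rewrite !mul0r.
have ge1 s : `|s| <= 1 -> good (fun=> 0) (e1 s) 1.
  move=> s1; split => i; first by rewrite /e1; case: ltngtP.
  by rewrite v0 add0r /e1; case: eqP => //; rewrite normr0.
have e1k s : e1 s k = s by rewrite /e1 eqxx.
have g1 := ge1 1 (eq_ind_r (fun x => x <= 1) (lexx 1) (normr1 R)).
have gN1 := ge1 (-1) (eq_ind_r (fun x => x <= 1) (lexx 1) (normrN1 R)).
have supS : has_sup S.
  split; first by exists (Fv (fun=> 0) (e1 (-1)) - C * 1); exists (fun=> 0), (e1 (-1)), 1.
  exists (C * 1 - Fv (fun=> 0) (e1 1)) => x [c' [d' [m' [h1 h2 ->]]]].
  exact: (key _ _ _ _ _ _ g1 h1 (e1k 1) h2).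
pose wk := sup S.
have lo c d m : good c d m -> d k = -1 -> Fv c d - wk <= C * m.
  move=> h1 h2; have : Fv c d - C * m <= wk by apply: ub_le_sup; [case: supS|exists c, d, m].
  by lra.
have hi c d m : good c d m -> d k = 1 -> Fv c d + wk <= C * m.
  move=> h1 h2; have : wk <= C * m - Fv c d.
    apply: ge_sup; first by case: supS.
    by move=> x [c' [d' [m' [h1' h2' ->]]]]; exact: (key _ _ _ _ _ _ h1 h1').
  by lra.
have scale a c d m : 0 <= a -> good c d m ->
    good (fun j => a * c j) (fun i => a * d i) (a * m).
  move=> a0 [h1 h2]; split => i hi'; first by rewrite h1// mulr0.
  by rewrite vZ -mulrDr normrM ger0_norm// ler_wpM2l// h2.
have FZ a c d : Fv (fun j => a * c j) (fun i => a * d i) = a * Fv c d.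
  rewrite /Fv pZ mulrDr mulr_sumr; congr (_ + _); apply: eq_bigr => i _.
  by rewrite mulrCA.
exists (fun i => if i == k then wk else w i) => c d m hd hm.
have gd : good c d m by [].
rewrite big_ord_recr /= eqxx.
rewrite (eq_bigr (fun i : 'I_k => w i * d i)); last by move=> i _; rewrite ltn_eqF.
rewrite addrA -/(Fv c d).
(* By homogeneity a nonzero d_k is rescaled to -1 or 1. *)
have [dk|dk|dk] := ltgtP (d k) 0.
- have a0 : 0 < (- d k)^-1 by rewrite invr_gt0 oppr_gt0.
  have := lo _ _ _ (scale _ _ _ _ (ltW a0) gd).
  have -> : (- d k)^-1 * d k = -1 by field; rewrite lt_eqF.
  move=> /(_ erefl); rewrite FZ => H.
  have -> : Fv c d + wk * d k = - d k * ((- d k)^-1 * Fv c d - wk).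
    by field; rewrite lt_eqF.
  have -> : C * m = - d k * (C * ((- d k)^-1 * m)) by field; rewrite lt_eqF.
  by rewrite ler_wpM2l// oppr_ge0 ltW.
- have a0 : 0 < (d k)^-1 by rewrite invr_gt0.
  have := hi _ _ _ (scale _ _ _ _ (ltW a0) gd).
  have -> : (d k)^-1 * d k = 1 by field; rewrite gt_eqF.
  move=> /(_ erefl); rewrite FZ => H.
  have -> : Fv c d + wk * d k = d k * ((d k)^-1 * Fv c d + wk).
    by field; rewrite gt_eqF.
  have -> : C * m = d k * (C * ((d k)^-1 * m)) by field; rewrite gt_eqF.
  by rewrite ler_wpM2l// ltW.
- rewrite dk mulr0 addr0; apply: IH => // i; rewrite leq_eqVlt => /predU1P[<-//|].
  exact: hd.
Qed.

(** In [norming_weights_step] the choice d = - v c, m = 0 gives phi c <= sum_i w_i v_i(c), and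
    equality follows by applying this to -c. The choice c = 0, d = sign of w, m = 1 gives the bound
    on sum_i |w_i|. *)
Lemma norming_weights (R : realType) (r M : nat) (v : ('I_r -> R) -> nat -> R)
    (phi : ('I_r -> R) -> R) (C : R) :
  (forall c c' i, v (fun j => c j + c' j) i = v c i + v c' i) ->
  (forall a c i, v (fun j => a * c j) i = a * v c i) ->
  (forall c c', phi (fun j => c j + c' j) = phi c + phi c') ->
  (forall a c, phi (fun j => a * c j) = a * phi c) ->
  (forall c m, (forall i, (i <= M)%N -> `|v c i| <= m) -> phi c <= C * m) ->
  exists w : nat -> R, \sum_(i < M.+1) `|w i| <= C /\
    forall c, phi c = \sum_(i < M.+1) w i * v c i.
Proof.
move=> vD vZ pD pZ hC.
have [w hw] := norming_weights_step M.+1 vD vZ pD pZ hC; exists w.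
have v0 i : v (fun=> 0) i = 0 by have := vZ 0 (fun=> 0) i; rewrite !mul0r.
have p0 : phi (fun=> 0) = 0 by have := pZ 0 (fun=> 0); rewrite !mul0r.
have le0 c : phi c <= \sum_(i < M.+1) w i * v c i.
  have := hw c (fun i => if (i <= M)%N then - v c i else 0) 0.
  rewrite mulr0 => H; rewrite -subr_le0 -sumrN; apply: le_trans (H _ _).
  - by rewrite lerD2l; apply: ler_sum => i _; rewrite -ltnS ltn_ord mulrN.
  - by move=> i; rewrite ltnNge => /negbTE ->.
  - by move=> i ->; rewrite subrr normr0.
split.
  have := hw (fun=> 0) (fun i => if (i <= M)%N then Num.sg (w i) else 0) 1.
  rewrite p0 add0r mulr1 => H; apply: le_trans (H _ _).
  - by apply: ler_sum => i _; rewrite -ltnS ltn_ord mulrC -normrEsg.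
  - by move=> i; rewrite ltnNge => /negbTE ->.
  - by move=> i ->; rewrite v0 add0r normr_sg; case: eqP => _; rewrite ?ler01 ?lexx.
move=> c; apply/eqP; rewrite eq_le le0 /=.
rewrite -lerN2; have := le0 (fun j => -1 * c j); rewrite pZ mulN1r.
congr (_ <= _); rewrite -sumrN; apply: eq_bigr => i _.
by rewrite vZ mulN1r mulrN.
Qed.

(** The last clause is the quadrature P'(0) = sum_i w_i P(g_i) tested on exponentials; it holds at
    every t by translation. *)
Lemma derivative_weights (R : realType) (n : nat) (lam : 'I_n.+1 -> R) (L : R) :
  0 < L -> exists (M : nat) (g w : nat -> R),
  [/\ forall i, (i <= M)%N -> 0 <= g i <= L,
     \sum_(i < M.+1) `|w i| <=
       5 * (5 + 4 * expR 1) * (224 / L + 1) * gamma_exp lam &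
     forall j, \sum_(i < M.+1) w i * expR (lam j * g i) = lam j].
Proof.
move=> L0; have k1 : 1 <= 5 * (5 + 4 * expR 1) :> R.
  have := expR_gt0 (1 : R); lra.
have gam0 : 0 <= \sum_j `|lam j| by exact: sumr_ge0.
(* For n = 0 the term n^2 of [gamma_exp] vanishes and cannot absorb r^2 = 1; there P' = lam P, a
   one-point quadrature. *)
case: n lam gam0 => [|n] lam gam0.
  exists 0%N, (fun=> 0), (fun=> lam ord0); split.
  - by move=> i _; rewrite lexx ltW.
  - rewrite big_ord1 /gamma_exp expr0n /= add0r big_ord1 ler_peMl//.
    by apply: mulr_ege1 => //; rewrite lerDr divr_ge0// ltW.
  - by move=> j; rewrite big_ord1 mulr0 expR0 mulr1; congr lam; apply/val_inj; case: j => [[]].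
have [M hM] := bernstein_grid lam (ltn0Sn n.+1) L0.
pose C := 5 * (5 + 4 * expR 1) * (56 * n.+2%:R ^+ 2 / L + \sum_j `|lam j|).
have [|||||w [w1 w2]] := @norming_weights R n.+2 M
  (fun c i => expsum lam c (i%:R * (L / M%:R))) (fun c => \sum_j c j * lam j) C.
- by move=> c c' i; rewrite -big_split /=; apply: eq_bigr => j _; rewrite mulrDl.
- by move=> a c i; rewrite /expsum mulr_sumr; apply: eq_bigr => j _; rewrite -mulrA.
- by move=> c c'; rewrite -big_split /=; apply: eq_bigr => j _; rewrite mulrDl.
- by move=> a c; rewrite mulr_sumr; apply: eq_bigr => j _; rewrite mulrA.
- by move=> c m /hM; apply: le_trans; exact: ler_norm.
exists M, (fun i => i%:R * (L / M%:R)), w; split.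
- move=> [|i] iM; first by rewrite mul0r lexx ltW.
  have MR : 0 < M%:R :> R by rewrite ltr0n (leq_trans _ iM).
  rewrite mulr_ge0 ?divr_ge0 ?(ltW L0)//= mulrA ler_pdivrMr// mulrC ler_wpM2l ?(ltW L0)//.
  by rewrite ler_nat.
- apply: (le_trans w1); rewrite /C -[leRHS]mulrA.
  apply: ler_wpM2l; first exact: (le_trans ler01 k1).
  rewrite /gamma_exp [leRHS]mulrDl mul1r.
  set S := \sum_j _; set x : R := n.+1%:R.
  have x1 : 1 <= x by rewrite /x ler1n.
  have -> : n.+2%:R = x + 1 :> R by rewrite /x natr1.
  (* With x = r - 1 >= 1, (x + 1)^2 <= 4 x^2 turns 56 into 224. *)
  have h1 : 56 * (x + 1) ^+ 2 / L <= 224 / L * x ^+ 2.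
    rewrite [leRHS]mulrAC ler_wpM2r ?invr_ge0 ?(ltW L0)//.
    by have := mulr_ge0 (le_trans ler01 x1) (le_trans ler01 x1); nra.
  have h2 : 0 <= 224 / L * S by rewrite mulr_ge0// divr_ge0// ltW.
  have h3 := sqr_ge0 x.
  by rewrite mulrDr; move: h1 h2 h3; lra.
- move=> j; have dl (F : 'I_n.+2 -> R) : \sum_i (i == j)%:R * F i = F j.
    rewrite (bigD1 j) //= eqxx mul1r big1 ?addr0// => i /negbTE ->.
    by rewrite mul0r.
  rewrite -[RHS](dl lam) w2; apply: eq_bigr => i _.
  by rewrite /expsum (dl (fun l => expR (lam l * (i%:R * (L / M%:R))))).
Qed.

(** * Function lattices *)

Lemma measurable_addr (R : realType) (g : R) :
  measurable_fun setT ((fun t => t + g) : R -> R).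
Proof. by apply: measurable_funD => //; exact: measurable_cst. Qed.

Lemma lebesgue_measure_translate (R : realType) (g : R) (A : set R) : measurable A ->
  @lebesgue_measure R ((fun t => t + g) @^-1` A) = @lebesgue_measure R A.
Proof.
move=> mA.
suff : pushforward (@lebesgue_measure R) ((fun t => t + g) : _ -> measurableTypeR R) A =
    lebesgue_measure A by [].
apply/esym; apply: lebesgue_measure_unique => //=.
  exact: measurable_addr.
move=> mg _ [[x y]] _ <-.
rewrite /pushforward /=.
have -> : +%R^~ g @^-1` [set` `]x, y]] = [set` `]x - g, y - g]].
  by apply/seteqP; split => t /=; rewrite !in_itv /= ltrBlDr lerBrDr.
by rewrite !lebesgue_measure_itv /= !lte_fin ltrD2r -!EFinB opprB addrA subrK.
Qed.

Lemma ae_onW (R : realType) (a b : R) (Q : R -> Prop) :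
  (forall t, a <= t <= b -> Q t) -> ae_on a b Q.
Proof. by move=> H; apply: aeW => t; rewrite in_itv /=; exact: H. Qed.

Lemma fl_norm_le (R : realType) (a b : R) (X : function_lattice a b) (f g : R -> R[i]) :
  fl_carrier X f -> fl_carrier X g ->
  (forall t, a <= t <= b -> cmod (f t) <= cmod (g t)) -> fl_norm X f <= fl_norm X g.
Proof. by move=> hf hg H; apply: fl_norm_mono => //; exact: ae_onW. Qed.

Lemma fl_carrier0 (R : realType) (a b : R) (X : function_lattice a b) :
  fl_carrier X (fun=> 0).
Proof.
have := @fl_scale R a b X 0 (cindic set0).
rewrite (_ : (fun t => _) = (fun=> 0)); last by apply/funext => t; rewrite mul0r.
by apply; apply: fl_indic => //; rewrite measure0.
Qed.

Lemma fl_norm0 (R : realType) (a b : R) (X : function_lattice a b) :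
  fl_norm X (fun=> 0) = 0.
Proof. by apply/fl_norm_eq0; [exact: fl_carrier0|exact: ae_onW]. Qed.

Lemma fl_norm_ge0 (R : realType) (a b : R) (X : function_lattice a b) (f : R -> R[i]) :
  fl_carrier X f -> 0 <= fl_norm X f.
Proof.
move=> hf; rewrite -(fl_norm0 X); apply: fl_norm_le => //; first exact: fl_carrier0.
by move=> t _; rewrite cmod0 cmod_ge0.
Qed.

Lemma fl_sub (R : realType) (a b : R) (X : function_lattice a b) (f g : R -> R[i]) :
  fl_carrier X f -> fl_carrier X g -> fl_carrier X (fun t => f t - g t).
Proof.
move=> hf hg; rewrite (_ : (fun t => _) = (fun t => f t + (-1) * g t)).
  by apply: fl_add => //; exact: fl_scale.
by apply/funext => t; rewrite mulN1r.
Qed.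

Lemma fl_sum (R : realType) (a b : R) (X : function_lattice a b) (n : nat)
    (F : nat -> R -> R[i]) :
  (forall k, (k < n)%N -> fl_carrier X (F k)) ->
  fl_carrier X (fun t => \sum_(k < n) F k t).
Proof.
elim: n => [_|n IH hF].
  rewrite (_ : (fun t => _) = (fun=> 0)); first exact: fl_carrier0.
  by apply/funext => t; rewrite big_ord0.
rewrite (_ : (fun t => _) = (fun t => \sum_(k < n) F k t + F n t)).
  by apply: fl_add; [apply: IH => k kn; apply: hF; exact: ltnW|exact: hF].
by apply/funext => t; rewrite big_ord_recr.
Qed.

Lemma fl_norm_sum (R : realType) (a b : R) (X : function_lattice a b) (n : nat)
    (F : nat -> R -> R[i]) :
  (forall k, (k < n)%N -> fl_carrier X (F k)) ->
  fl_norm X (fun t => \sum_(k < n) F k t) <= \sum_(k < n) fl_norm X (F k).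
Proof.
elim: n => [_|n IH hF].
  rewrite big_ord0 (_ : (fun t => _) = (fun=> 0)) ?fl_norm0//.
  by apply/funext => t; rewrite big_ord0.
rewrite (_ : (fun t => _) = (fun t => \sum_(k < n) F k t + F n t)); last first.
  by apply/funext => t; rewrite big_ord_recr.
have hF' k : (k < n)%N -> fl_carrier X (F k) by move=> kn; apply: hF; exact: ltnW.
rewrite big_ord_recr /=; apply: (le_trans (fl_normD (fl_sum hF') (hF n _))) => //.
by rewrite lerD2r IH.
Qed.

Definition box (R : realType) (a b : R) : R -> R[i] := cindic [set t : R | a <= t <= b].

Lemma box_itv (R : realType) (a b : R) : [set t : R | a <= t <= b] = `[a, b]%classic.
Proof. by apply/seteqP; split => t /=; rewrite in_itv. Qed.

Lemma cindic_in (R : realType) (B : set R) (t : R) : B t -> cindic B t = 1.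
Proof. by move=> Bt; rewrite /cindic indicE mem_set. Qed.

Lemma cindic_out (R : realType) (B : set R) (t : R) : ~ B t -> cindic B t = 0.
Proof. by move=> Bt; rewrite /cindic indicE memNset. Qed.

Lemma box_carrier (R : realType) (a b u v : R) (X : function_lattice a b) :
  a <= u -> v <= b -> fl_carrier X (box u v).
Proof.
move=> au vb; rewrite /box box_itv; apply: fl_indic.
- by apply: subset_itv; rewrite bnd_simp.
- exact: measurable_itv.
- by rewrite lebesgue_measure_itv /=; case: ifP => _; rewrite ?ltry// -EFinB ltry.
Qed.

Lemma inv_small (R : realType) (e : R) : 0 < e -> exists m : nat, m.+1%:R^-1 <= e.
Proof.
move=> e0; exists (Num.truncn e^-1).
have /andP[_ h] : (Num.truncn e^-1)%:R <= e^-1 < (Num.truncn e^-1).+1%:R.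
  by apply: truncn_itv; rewrite invr_ge0 ltW.
by rewrite -[leRHS]invrK lef_pV2 ?posrE ?invr_gt0// ltW.
Qed.

Lemma cmeasurable_sub (R : realType) (a b : R) (f g : R -> R[i]) :
  cmeasurable a b f -> cmeasurable a b g -> cmeasurable a b (fun t => f t - g t).
Proof.
move=> [f1 f2] [g1 g2]; split.
  rewrite (_ : (fun t => _) = (fun t => complex.Re (f t)) \- (fun t => complex.Re (g t))).
    exact: measurable_funB.
  by apply/funext => t; rewrite raddfB.
rewrite (_ : (fun t => _) = (fun t => complex.Im (f t)) \- (fun t => complex.Im (g t))).
  exact: measurable_funB.
by apply/funext => t; rewrite raddfB.
Qed.

Lemma measurable_cmod (R : realType) (a b : R) (f : R -> R[i]) :
  cmeasurable a b f -> measurable_fun `[a, b]%classic (fun t => cmod (f t)).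
Proof.
move=> [f1 f2].
have m1 : measurable_fun `[a, b]%classic
    (fun t => complex.Re (f t) ^+ 2 + complex.Im (f t) ^+ 2).
  by apply: measurable_funD; exact: measurable_funX.
rewrite (_ : (fun t => _) = Num.sqrt \o
    (fun t => complex.Re (f t) ^+ 2 + complex.Im (f t) ^+ 2)).
  apply: measurableT_comp m1; apply: continuous_measurable_fun.
  exact: sqrt_continuous.
by apply/funext => t /=; rewrite -cmod_sqr sqrtr_sqr ger0_norm ?cmod_ge0.
Qed.

Lemma ae_lebesgueS (R : realType) (P Q : R -> Prop) : (forall t, P t -> Q t) ->
  {ae @lebesgue_measure R, forall t, P t} -> {ae @lebesgue_measure R, forall t, Q t}.
Proof. by move=> PQ; apply: negligibleS => t /= nQ pt; apply: nQ; exact: PQ. Qed.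

(** Uniform convergence makes u_m Cauchy in X because the indicator of [a, b] lies in X.
    Completeness yields a norm limit f, and f = g almost everywhere since each set |f - g| >= 1 / (j
    + 1) has an indicator of norm 0. *)
Lemma fl_unif_limit (R : realType) (a b : R) (X : function_lattice a b)
    (u : nat -> R -> R[i]) (g : R -> R[i]) :
  (forall m, fl_carrier X (u m)) -> cmeasurable a b g ->
  (forall m t, a <= t <= b -> cmod (u m t - g t) <= m.+1%:R^-1) ->
  fl_carrier X g.
Proof.
move=> hu hg hug.
have hbox : fl_carrier X (box a b) by exact: box_carrier.
pose kp := fl_norm X (box a b); have kp0 : 0 <= kp by exact: fl_norm_ge0.
have cauchy e : 0 < e -> exists M : nat, forall p q : nat, (M <= p)%N -> (M <= q)%N ->
    fl_norm X (fun t => u p t - u q t) < e.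
  move=> e0; have e1 : 0 < e / (2 * kp + 1) by rewrite divr_gt0// ltr_wpDl// mulr_ge0.
  have [M hM] := inv_small e1; exists M => p q Mp Mq.
  have le1 p' : (M <= p')%N -> p'.+1%:R^-1 <= M.+1%:R^-1 :> R.
    by move=> h; rewrite lef_pV2 ?posrE ?ltr0n// ler_nat.
  apply: (@le_lt_trans _ _ (fl_norm X (fun t => (2 * M.+1%:R^-1)%:C * box a b t))).
    apply: fl_norm_le; [exact: fl_sub|exact: fl_scale|move=> t tab].
    rewrite /box cindic_in// mulr1 cmod_real ger0_norm ?mulr_ge0// ?invr_ge0//.
    have -> : u p t - u q t = (u p t - g t) - (u q t - g t) by ring.
    apply: (le_trans (cmodB _ _)); rewrite mulr_natl mulr2n.
    by apply: lerD; apply: (le_trans (hug _ _ tab)); exact: le1.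
  rewrite fl_normZ// cmod_real ger0_norm ?mulr_ge0// ?invr_ge0// -/kp.
  apply: (@le_lt_trans _ _ (2 * (e / (2 * kp + 1)) * kp)).
    by rewrite ler_wpM2r// ler_wpM2l.
  rewrite mulrAC mulrA ltr_pdivrMr; last by rewrite ltr_wpDl// mulr_ge0.
  by rewrite mulrC ltr_pM2l// ltrDl.
have [f hf /cvgrPdist_le hlim] := fl_complete hu cauchy.
have [mf _] := fl_L1 hf.
pose E j := `[a, b]%classic `&` (fun t => cmod (f t - g t)) @^-1` `[j.+1%:R^-1, +oo[%classic.
have mE j : measurable (E j).
  by apply: (measurable_cmod (cmeasurable_sub mf hg)) => //; exact: measurable_itv.
have Efin j : (@lebesgue_measure R (E j) < +oo)%E.
  apply: (@le_lt_trans _ _ (@lebesgue_measure R `[a, b]%classic)).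
    by apply: le_measure; rewrite ?inE; [exact: mE|exact: measurable_itv|exact: subIsetl].
  by rewrite lebesgue_measure_itv /=; case: ifP => _; rewrite ?ltry// -EFinB ltry.
have cE j : fl_carrier X (cindic (E j)) by apply: fl_indic => //; exact: subIsetl.
have nE j : fl_norm X (cindic (E j)) = 0.
  (* Half the threshold: once |u_m - g| <= d, one has |u_m - f| >= d on [E j], so d times the norm
     of its indicator is at most the norm of u_m - f. *)
  pose d : R := j.+1%:R^-1 / 2; have d0 : 0 < d by rewrite divr_gt0// invr_gt0.
  apply/eqP; rewrite eq_le fl_norm_ge0// andbT; apply/ler_addgt0Pr => e e0; rewrite add0r.
  have ed : 0 < d * e by rewrite mulr_gt0.
  have [m1 h1] := inv_small d0; have [m2 _ h2] := hlim _ ed.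
  pose m := maxn m1 m2; have := h2 m (leq_maxr _ _); rewrite /= sub0r normrN.
  move=> /(le_trans (ler_norm _)) h3; rewrite -(ler_pM2l d0); apply: le_trans h3.
  have -> : d * fl_norm X (cindic (E j)) = fl_norm X (fun t => d%:C * cindic (E j) t).
    by rewrite fl_normZ// cmod_real gtr0_norm.
  apply: fl_norm_le; [exact: fl_scale|exact: fl_sub|move=> t tab].
  have [Et|Et] := pselect (E j t); last by rewrite cindic_out// mulr0 cmod0 cmod_ge0.
  rewrite cindic_in// mulr1 cmod_real gtr0_norm//.
  have [_ /=] := Et; rewrite in_itv /= andbT => H.
  have H1 : cmod (u m t - g t) <= d.
    apply: (le_trans (hug m t tab)); apply: le_trans h1.
    by rewrite lef_pV2 ?posrE ?ltr0n// ler_nat ltnS leq_maxl.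
  have H2 : cmod (f t - g t) <= cmod (u m t - f t) + cmod (u m t - g t).
    have -> : f t - g t = (u m t - g t) - (u m t - f t) by ring.
    by rewrite [leRHS]addrC; exact: cmodB.
  have dd : j.+1%:R^-1 = d + d by rewrite /d -splitr.
  by move: H H1 H2; rewrite dd; lra.
apply: (fl_ae hf hg).
have aeE : {ae @lebesgue_measure R, forall t, forall j : nat, t \in `[a, b] -> ~ E j t}.
  apply: ae_foralln => j.
  have := (fl_norm_eq0 (cE j)).1 (nE j); apply: ae_lebesgueS => t H tab Et.
  by move: (H tab); rewrite cindic_in// => /eqP; rewrite oner_eq0.
move: aeE; apply: ae_lebesgueS => t H tab.
apply/eqP; rewrite -subr_eq0; apply/eqP/cmod_eq0/eqP.
rewrite eq_le cmod_ge0 andbT leNgt; apply/negP => c0.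
have c2 : 0 < cmod (f t - g t) / 2 by rewrite divr_gt0.
have [j hj] := inv_small c2; apply: (H j tab); split => //=.
rewrite in_itv /= andbT; apply: (le_trans hj).
by rewrite ler_pdivrMr// ler_peMr ?ler1n// ltW.
Qed.

(** Uniform limit of the step functions that round g down to a multiple of 1 / (m + 1). *)
Lemma fl_bounded_nneg (R : realType) (a b M : R) (X : function_lattice a b) (g : R -> R) :
  measurable_fun `[a, b]%classic g -> (forall t, a <= t <= b -> 0 <= g t <= M) ->
  fl_carrier X (fun t => (g t)%:C).
Proof.
move=> mg hg.
pose B m k : set R := `[a, b]%classic `&` g @^-1` `[k%:R / m.+1%:R, k.+1%:R / m.+1%:R[%classic.
pose K m := (Num.truncn (m.+1%:R * M)).+1.
pose u m t := \sum_(k < K m) (k%:R / m.+1%:R)%:C * cindic (B m k) t.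
apply: (@fl_unif_limit _ _ _ _ u).
- move=> m; apply: (@fl_sum _ _ _ _ _ (fun k t => (k%:R / m.+1%:R)%:C * cindic (B m k) t)).
  move=> k _; apply: fl_scale; apply: fl_indic; first exact: subIsetl.
    by apply: mg => //; exact: measurable_itv.
  apply: (@le_lt_trans _ _ (@lebesgue_measure R `[a, b]%classic)).
    apply: le_measure; rewrite ?inE; [|exact: measurable_itv|exact: subIsetl].
    by apply: mg => //; exact: measurable_itv.
  by rewrite lebesgue_measure_itv /=; case: ifP => _; rewrite ?ltry// -EFinB ltry.
- split => //=; exact: measurable_cst.
- move=> m t tab; have /andP[g0 gM] := hg t tab; have m0 : 0 < m.+1%:R :> R by rewrite ltr0n.
  pose k := Num.truncn (m.+1%:R * g t).
  have /andP[k1 k2] : k%:R <= m.+1%:R * g t < k.+1%:R.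
    by apply: truncn_itv; rewrite mulr_ge0// ltW.
  have kK : (k < K m)%N.
    by rewrite /K ltnS /k; apply: le_truncn; rewrite ler_wpM2l// ltW.
  have Bk : B m k t.
    split; first by rewrite /= in_itv.
    by rewrite /= in_itv /= ler_pdivrMr// ltr_pdivlMr// mulrC k1 k2.
  have -> : u m t = (k%:R / m.+1%:R)%:C.
    rewrite /u (bigD1 (Ordinal kK)) //= cindic_in// mulr1 big1 ?addr0// => i ik.
    rewrite cindic_out ?mulr0// => -[_]; rewrite /= in_itv /= ler_pdivrMr// ltr_pdivlMr//.
    move=> /andP[i1 i2]; move/negP: ik; apply; apply/eqP/val_inj => /=.
    apply/eqP; rewrite eqn_leq; apply/andP; split.
      by rewrite -ltnS -(ltr_nat R); apply: le_lt_trans k2; rewrite mulrC.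
    by rewrite -ltnS -(ltr_nat R); apply: le_lt_trans i2; rewrite mulrC in k1.
  have -> : (k%:R / m.+1%:R)%:C - (g t)%:C = (k%:R / m.+1%:R - g t)%:C by rewrite rmorphB.
  rewrite cmod_real distrC ger0_norm; last first.
    by rewrite subr_ge0 ler_pdivrMr// mulrC.
  rewrite lerBlDr.
  have -> : m.+1%:R^-1 + k%:R / m.+1%:R = k.+1%:R / m.+1%:R :> R.
    by rewrite -[k.+1%:R]natr1 mulrDl mul1r addrC.
  by rewrite ler_pdivlMr// mulrC; exact: ltW.
Qed.

(** Real and imaginary parts are shifted by M to become nonnegative; the shift is undone by a
    multiple of [box a b], up to values outside [a, b]. *)
Lemma fl_bounded (R : realType) (a b M : R) (X : function_lattice a b) (f : R -> R[i]) :
  cmeasurable a b f -> (forall t, a <= t <= b -> cmod (f t) <= M) ->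
  fl_carrier X f.
Proof.
move=> [f1 f2] hf.
have ReIm (z : R[i]) : `|complex.Re z| <= cmod z /\ `|complex.Im z| <= cmod z.
  by split; rewrite -ler_sqr ?nnegrE ?cmod_ge0// real_normK ?num_real// cmod_sqr ?lerDl ?lerDr sqr_ge0.
have hbox : fl_carrier X (fun t => (- M)%:C * box a b t).
  by apply: fl_scale; exact: box_carrier.
have real (g : R -> R) : measurable_fun `[a, b]%classic g ->
    (forall t, a <= t <= b -> `|g t| <= M) -> fl_carrier X (fun t => (g t)%:C).
  move=> mg hg.
  have h := @fl_bounded_nneg R a b (2 * M) X (fun t => g t + M).
  apply: (@fl_ae _ _ _ _ (fun t => (g t + M)%:C + (- M)%:C * box a b t)).
  - apply: fl_add => //; apply: h.
      by apply: measurable_funD => //; exact: measurable_cst.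
    by move=> t /hg; rewrite ler_norml => /andP[h1 h2]; apply/andP; split; lra.
  - by split => //=; exact: measurable_cst.
  - apply: ae_onW => t tab; rewrite /box cindic_in// mulr1 -rmorphD /=.
    by rewrite addrK.
rewrite (_ : f = fun t => (complex.Re (f t))%:C + 'i%C * (complex.Im (f t))%:C).
  apply: fl_add; [|apply: fl_scale]; apply: real => // t tab.
    by apply: le_trans (hf t tab); case: (ReIm (f t)).
  by apply: le_trans (hf t tab); case: (ReIm (f t)).
by apply/funext => t; rewrite -complexE.
Qed.

(** * Exponential sums in a rearrangement invariant lattice *)

Definition exp_partial (R : realType) (M : nat) (u : R) : R :=
  \sum_(m < M) u ^+ m / m`!%:R.

Lemma exp_partial_cvg (R : realType) (u e : R) : 0 < e ->
  exists K0 : nat, forall K : nat, (K0 <= K)%N -> `|expR u - exp_partial K u| <= e.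
Proof.
move=> e0; have /cvgrPdist_le /(_ e e0) [K0 _ hK] : series (exp_coeff u) @ \oo --> expR u.
  exact: is_cvg_series_exp_coeff.
by exists K0 => K /hK; rewrite /series /= big_mkord.
Qed.

(** The tails are compared termwise on partial sums of order K >= M; letting the error e tend to 0
    gives the series. *)
Lemma expR_tail (R : realType) (u U : R) (M : nat) : `|u| <= U ->
  `|expR u - exp_partial M u| <= expR U - exp_partial M U.
Proof.
move=> uU; apply/ler_addgt0Pr => e e0; have e2 : 0 < e / 2 by rewrite divr_gt0.
have [K1 h1] := exp_partial_cvg u e2; have [K2 h2] := exp_partial_cvg U e2.
pose k := maxn K1 K2; pose K := (M + k)%N.
have {}h1 : `|expR u - exp_partial K u| <= e / 2.
  by apply: h1; rewrite /K /k; lia.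
have {}h2 : `|expR U - exp_partial K U| <= e / 2.
  by apply: h2; rewrite /K /k; lia.
have split x : exp_partial K x = exp_partial M x +
    \sum_(i < k) x ^+ (M + i) / (M + i)`!%:R.
  by rewrite /exp_partial /K big_split_ord.
have tail : `|exp_partial K u - exp_partial M u| <= exp_partial K U - exp_partial M U.
  rewrite !split [X in `|X|]addrAC subrr add0r [leRHS]addrAC subrr add0r.
  apply: (le_trans (ler_norm_sum _ _ _)); apply: ler_sum => i _.
  rewrite normrM normrX [`|_^-1|]ger0_norm ?invr_ge0//.
  rewrite ler_wpM2r ?invr_ge0// lerXn2r ?nnegrE//; exact: le_trans uU.
have -> : expR u - exp_partial M u = (expR u - exp_partial K u) +
  (exp_partial K u - exp_partial M u) by ring.
apply: (le_trans (ler_normD _ _)).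
move: h2; rewrite ler_norml => /andP[h2 _].
by move: h1 tail h2; lra.
Qed.

Lemma exp_partial_le (R : realType) (M : nat) (u : R) : 0 <= u -> exp_partial M u <= expR u.
Proof.
move=> u0; rewrite -subr_ge0; apply: le_trans (expR_tail M (_ : `|u| <= u)).
  exact: normr_ge0.
by rewrite ger0_norm.
Qed.

Definition cexpsum (R : realType) (r : nat) (lam : 'I_r -> R) (c : 'I_r -> R[i]) (t : R)
    : R[i] := \sum_(j < r) c j * (expR (lam j * t))%:C.

Lemma cexpsum_shift (R : realType) (r : nat) (lam : 'I_r -> R) (c : 'I_r -> R[i]) (t g : R) :
  cexpsum lam c (t + g) = cexpsum lam (fun j => c j * (expR (lam j * g))%:C) t.
Proof.
apply: eq_bigr => j _; rewrite mulrDr addrC expRD rmorphM /=; ring.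
Qed.

Lemma cmeasurable_cexpsum (R : realType) (a b : R) (r : nat) (lam : 'I_r -> R)
    (c : 'I_r -> R[i]) : cmeasurable a b (cexpsum lam c).
Proof.
have meas (d : 'I_r -> R) : measurable_fun `[a, b]%classic (expsum lam d).
  apply: (@measurable_funS _ _ _ _ setT) => //.
  apply: continuous_measurable_fun => x; apply: differentiable_continuous.
  by apply/derivable1_diffP; have [] := is_derive_expsum lam d x.
split.
  rewrite (_ : (fun t => _) = expsum lam (fun j => complex.Re (c j))) //.
  apply/funext => t; rewrite raddf_sum; apply: eq_bigr => j _.
  by case: (c j) => x y /=; rewrite mulr0 subr0.
rewrite (_ : (fun t => _) = expsum lam (fun j => complex.Im (c j))) //.
apply/funext => t; rewrite raddf_sum; apply: eq_bigr => j _.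
by case: (c j) => x y /=; rewrite mulr0 add0r.
Qed.

Lemma cexpsum_bounded (R : realType) (a b : R) (r : nat) (lam : 'I_r -> R)
    (c : 'I_r -> R[i]) :
  exists B : R, forall t, a <= t <= b -> cmod (cexpsum lam c t) <= B.
Proof.
exists (\sum_j cmod (c j) * expR (`|lam j| * (`|a| + `|b|))) => t /andP[at_ tb].
apply: (le_trans (cmod_sum _ _ _)); apply: ler_sum => j _.
rewrite cmodM cmod_real ger0_norm ?expR_ge0// ler_wpM2l ?cmod_ge0// ler_expR.
apply: (le_trans (ler_norm _)); rewrite normrM ler_wpM2l// ler_norml.
have := ler_norm b; have := ler_norm (- a); rewrite normrN => h1 h2.
have := normr_ge0 b; have := normr_ge0 a => h3 h4.
by apply/andP; split; lra.
Qed.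

Lemma fl_cexpsum (R : realType) (a b : R) (X : function_lattice a b) (r : nat)
    (lam : 'I_r -> R) (c : 'I_r -> R[i]) : fl_carrier X (cexpsum lam c).
Proof.
have [B hB] := cexpsum_bounded a b lam c.
exact: fl_bounded (cmeasurable_cexpsum a b lam c) hB.
Qed.

Lemma fl_cmod (R : realType) (a b : R) (X : function_lattice a b) (r : nat)
    (lam : 'I_r -> R) (c : 'I_r -> R[i]) :
  fl_carrier X (fun t => (cmod (cexpsum lam c t))%:C).
Proof.
have [B hB] := cexpsum_bounded a b lam c.
apply: (@fl_bounded _ _ _ B).
  split => /=; last exact: measurable_cst.
  by apply: measurable_cmod; exact: cmeasurable_cexpsum.
by move=> t /hB; rewrite cmod_real ger0_norm ?cmod_ge0.
Qed.

Lemma fl_box_cexpsum (R : realType) (a b u v : R) (X : function_lattice a b) (r : nat)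
    (lam : 'I_r -> R) (c : 'I_r -> R[i]) :
  fl_carrier X (fun t => box u v t * cexpsum lam c t).
Proof.
have [B hB] := cexpsum_bounded a b lam c.
have [m1 m2] := cmeasurable_cexpsum a b lam c.
have mI : measurable_fun `[a, b]%classic (\1_[set t | u <= t <= v] : R -> R).
  by apply: measurable_indic; rewrite box_itv; exact: measurable_itv.
apply: (@fl_bounded _ _ _ B).
  split.
    rewrite (_ : (fun t => _) = (\1_[set t | u <= t <= v] : R -> R) \*
      (fun t => complex.Re (cexpsum lam c t))); first exact: measurable_funM.
    by apply/funext => t /=; case: (cexpsum lam c t) => x y /=; rewrite mul0r subr0.
  rewrite (_ : (fun t => _) = (\1_[set t | u <= t <= v] : R -> R) \*
    (fun t => complex.Im (cexpsum lam c t))); first exact: measurable_funM.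
  by apply/funext => t /=; case: (cexpsum lam c t) => x y /=; rewrite mul0r addr0.
move=> t tab; apply: le_trans (hB t tab); rewrite /box.
have [Bt|Bt] := pselect ([set t | u <= t <= v] t).
  by rewrite cindic_in// mul1r.
by rewrite cindic_out// mul0r cmod0 cmod_ge0.
Qed.

(* [box u v * P(. + g)] is a translate of [box (u + g) (v + g) * P], hence
   equimeasurable with it. *)
Lemma fl_norm_translate (R : realType) (a b u v g : R) (X : function_lattice a b)
    (r : nat) (lam : 'I_r -> R) (c : 'I_r -> R[i]) :
  rearrangement_invariant X -> a <= u -> v <= b -> a <= u + g -> v + g <= b ->
  fl_norm X (fun t => box u v t * cexpsum lam c (t + g)) <= fl_norm X (cexpsum lam c).
Proof.
move=> hX au vb aug vgb.
pose F t := box u v t * cexpsum lam c (t + g).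
pose H t := box (u + g) (v + g) t * cexpsum lam c t.
have cF : fl_carrier X F.
  rewrite (_ : F = fun t => box u v t *
    cexpsum lam (fun j => c j * (expR (lam j * g))%:C) t); first exact: fl_box_cexpsum.
  by apply/funext => t; rewrite /F cexpsum_shift.
have cH : fl_carrier X H by exact: fl_box_cexpsum.
have -> : fl_norm X F = fl_norm X H.
  apply: hX => //; apply/funext => y; rewrite /distr_fun.
  (* For y <= 0 both level sets are all of [a, b]; for y > 0 they lie inside the boxes and are
     translates of each other. *)
  have [y0|y0] := leP y 0.
    congr (lebesgue_measure _); apply/seteqP; split => t /= [tab _]; split => //;
    exact: le_trans (cmod_ge0 _).
  have mH : measurable [set t | t \in `[a, b] /\ y <= cmod (H t)].
    rewrite (_ : [set t | _] = `[a, b]%classic `&`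
        (fun t => cmod (H t)) @^-1` `[y, +oo[%classic).
      by have [mHc _] := fl_L1 cH; apply: (measurable_cmod mHc); exact: measurable_itv.
    by apply/seteqP; split => t /= [tab]; rewrite [_ \in `[y, +oo[]in_itv /= andbT.
  rewrite -(lebesgue_measure_translate g mH); congr (lebesgue_measure _).
  have inb p q t (z : R[i]) : y <= cmod (box p q t * z) -> p <= t <= q.
    have [//|nt] := pselect ([set t | p <= t <= q] t).
    by rewrite /box cindic_out// mul0r cmod0 leNgt y0.
  apply/seteqP; split => t /= [tab yt]; have := inb _ _ _ _ yt.
    move=> utv; have utv' : u + g <= t + g <= v + g by rewrite !lerD2r.
    split; first by rewrite in_itv /=; move: utv' aug vgb => /andP[]; lra.
    by move: yt; rewrite /F /H /box !cindic_in.
  rewrite !lerD2r => utv; split; first by rewrite in_itv /=; move: utv => /andP[]; lra.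
  by move: yt; rewrite /F /H /box !cindic_in//= !lerD2r.
apply: fl_norm_le => //; first exact: fl_cexpsum.
move=> t _; rewrite /H /box.
have [Bt|Bt] := pselect ([set t | u + g <= t <= v + g] t).
  by rewrite cindic_in// mul1r.
by rewrite cindic_out// mul0r cmod0 cmod_ge0.
Qed.

(** The sign s selects forward or backward translates: the derivative is sum_i s w_i P(t + s g_i),
    and each translate restricted to [u, v] is bounded by [fl_norm_translate]. *)
Lemma fl_norm_half (R : realType) (a b u v s : R) (X : function_lattice a b) (n : nat)
    (lam : 'I_n.+1 -> R) (c : 'I_n.+1 -> R[i]) (M : nat) (g w : nat -> R) (C : R) :
  rearrangement_invariant X -> a <= u -> v <= b -> cmod s%:C = 1 ->
  (forall i, (i <= M)%N -> a <= u + s * g i /\ v + s * g i <= b) ->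
  \sum_(i < M.+1) `|w i| <= C ->
  (forall j, \sum_(i < M.+1) w i * expR (lam j * (s * g i)) = s * lam j) ->
  fl_norm X (fun t => box u v t * cexpsum lam (fun j => c j * (lam j)%:C) t) <=
    C * fl_norm X (cexpsum lam c).
Proof.
move=> hX au vb s1 hg hw hlam; set P := cexpsum lam c.
pose F i t := (s * w i)%:C * (box u v t * cexpsum lam c (t + s * g i)).
have ss : s * s = 1.
  by move: s1; rewrite cmod_real -expr2 => s1; rewrite -real_normK ?num_real// s1 expr1n.
have cT i : fl_carrier X (fun t => box u v t * cexpsum lam c (t + s * g i)).
  rewrite (_ : (fun t => _) = fun t => box u v t *
    cexpsum lam (fun j => c j * (expR (lam j * (s * g i)))%:C) t).
    exact: fl_box_cexpsum.
  by apply/funext => t; rewrite cexpsum_shift.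
have -> : (fun t => box u v t * cexpsum lam (fun j => c j * (lam j)%:C) t) =
    (fun t => \sum_(i < M.+1) F i t).
  apply/funext => t; rewrite /F.
  under [RHS]eq_bigr do rewrite mulrCA cexpsum_shift.
  rewrite -mulr_sumr; congr (_ * _); rewrite /cexpsum.
  under [RHS]eq_bigr do rewrite mulr_sumr.
  rewrite exchange_big /=; apply: eq_bigr => j _.
  have -> : (lam j)%:C = \sum_(i < M.+1) (s * w i)%:C * (expR (lam j * (s * g i)))%:C :> R[i].
    transitivity (s * (s * lam j))%:C; first by rewrite mulrA ss mul1r.
    rewrite -hlam mulr_sumr rmorph_sum /=.
    by apply: eq_bigr => i _; rewrite mulrA rmorphM.
  by rewrite mulr_sumr mulr_suml; apply: eq_bigr => i _; ring.
have cF i : fl_carrier X (F i) by apply: fl_scale.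
apply: (le_trans (fl_norm_sum _)) => // {}.
apply: (@le_trans _ _ (\sum_(i < M.+1) `|w i| * fl_norm X P)).
  apply: ler_sum => i _; rewrite /F fl_normZ//.
  have -> : cmod (s * w i)%:C = `|w i|.
    by rewrite cmod_real normrM; move: s1; rewrite cmod_real => ->; rewrite mul1r.
  rewrite ler_wpM2l//; have [h1 h2] : a <= u + s * g i /\ v + s * g i <= b.
    by apply: hg; rewrite -ltnS.
  exact: fl_norm_translate.
by rewrite -mulr_suml ler_wpM2r// fl_norm_ge0//; exact: fl_cexpsum.
Qed.

(** The factor 2 counts the two halves of [a, b], each treated by [derivative_weights] with L = (b -
    a) / 2. *)
Definition bernstein_const (R : realType) (a b : R) : R :=
  2 * (5 * (5 + 4 * expR 1) * (224 / ((b - a) / 2) + 1)).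

Lemma bernstein_const_gt0 (R : realType) (a b : R) : a < b -> 0 < bernstein_const a b.
Proof.
move=> ab; have e0 := expR_gt0 (1 : R).
have h : 0 < 224 / ((b - a) / 2) + 1 :> R.
  by rewrite addr_gt0// divr_gt0// divr_gt0// subr_gt0.
by rewrite /bernstein_const !mulr_gt0// addr_gt0// mulr_gt0.
Qed.

Lemma fl_bernstein (R : realType) (a b : R) (X : function_lattice a b) (n : nat)
    (lam : 'I_n.+1 -> R) (c : 'I_n.+1 -> R[i]) :
  a < b -> rearrangement_invariant X ->
  fl_norm X (cexpsum lam (fun j => c j * (lam j)%:C)) <=
    bernstein_const a b * gamma_exp lam * fl_norm X (cexpsum lam c).
Proof.
move=> ab hX; pose L := (b - a) / 2; have L0 : 0 < L by rewrite divr_gt0// subr_gt0.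
pose m := (a + b) / 2.
have mE : m = a + L by rewrite /m /L; field.
have mE' : m = b - L by rewrite /m /L; field.
pose C := 5 * (5 + 4 * expR 1) * (224 / L + 1) * gamma_exp lam.
pose Q := cexpsum lam (fun j => c j * (lam j)%:C).
have left : fl_norm X (fun t => box a m t * Q t) <= C * fl_norm X (cexpsum lam c).
  have [M [g [w [hg hw hl]]]] := derivative_weights lam L0.
  apply: (@fl_norm_half _ _ _ _ _ 1 _ _ _ _ M g w) => //.
  - by rewrite mE' gerBl ltW.
  - by rewrite cmod_real normr1.
  - by move=> i /hg /andP[g0 gL]; rewrite mul1r lerDl g0 mE'; split => //; lra.
  - by move=> j; rewrite mul1r -[RHS]hl; apply: eq_bigr => i _; rewrite mul1r.
have right : fl_norm X (fun t => box m b t * Q t) <= C * fl_norm X (cexpsum lam c).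
  have [M [g [w [hg hw hl]]]] := derivative_weights (fun j => - lam j) L0.
  apply: (@fl_norm_half _ _ _ _ _ (-1) _ _ _ _ M g w) => //.
  - by rewrite mE lerDl ltW.
  - by rewrite cmod_real normrN1.
  - by move=> i /hg /andP[g0 gL]; rewrite mulN1r mE; split; lra.
  - apply: (le_trans hw); rewrite /C /gamma_exp.
    by under eq_bigr do rewrite normrN.
  - by move=> j; rewrite mulN1r -[RHS]hl; apply: eq_bigr => i _; rewrite mulN1r mulrN mulNr.
have cb u v : fl_carrier X (fun t => box u v t * Q t) by exact: fl_box_cexpsum.
have -> : bernstein_const a b * gamma_exp lam * fl_norm X (cexpsum lam c) =
  C * fl_norm X (cexpsum lam c) + C * fl_norm X (cexpsum lam c).
  by rewrite /bernstein_const /C -/L; ring.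
apply: le_trans (lerD left right); apply: le_trans (fl_normD (cb a m) (cb m b)).
apply: fl_norm_mono; [exact: fl_cexpsum|by apply: fl_add|].
(* Away from the midpoint exactly one of the two boxes equals 1. *)
exists [set m]; split; [exact: measurable_set1|exact: lebesgue_measure_set1|].
move=> t /= nt; apply: contrapT => tm; apply: nt; rewrite in_itv /= => /andP[at_ tb].
rewrite /box -mulrDl cmodM -[X in X <= _]mul1r ler_wpM2r ?cmod_ge0//.
have [tlm|tgm|//] := ltgtP t m.
  have h1 : [set t0 | a <= t0 <= m] t by rewrite /= at_ ltW.
  have h2 : ~ [set t0 | m <= t0 <= b] t by move=> /andP[]; rewrite leNgt tlm.
  by rewrite (cindic_in h1) (cindic_out h2) addr0 cmod1.
have h1 : [set t0 | m <= t0 <= b] t by rewrite /= tb ltW.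
have h2 : ~ [set t0 | a <= t0 <= m] t by move=> /andP[_]; rewrite leNgt tgm.
by rewrite (cindic_in h1) (cindic_out h2) add0r cmod1.
Qed.

Lemma fl_bernstein_iter (R : realType) (a b : R) (X : function_lattice a b) (n : nat)
    (lam : 'I_n.+1 -> R) (c : 'I_n.+1 -> R[i]) (m : nat) :
  a < b -> rearrangement_invariant X ->
  fl_norm X (cexpsum lam (fun j => c j * (lam j ^+ m)%:C)) <=
    (bernstein_const a b * gamma_exp lam) ^+ m * fl_norm X (cexpsum lam c).
Proof.
move=> ab hX; have B0 : 0 <= bernstein_const a b * gamma_exp lam.
  rewrite mulr_ge0 ?(ltW (bernstein_const_gt0 ab))//.
  by rewrite addr_ge0 ?sqr_ge0// sumr_ge0.
elim: m => [|m IH].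
  rewrite expr0 mul1r le_eqVlt; apply/orP; left; apply/eqP; congr fl_norm.
  by congr cexpsum; apply/funext => j; rewrite expr0 mulr1.
rewrite exprS -mulrA; apply: le_trans (ler_wpM2l B0 IH).
apply: le_trans (fl_bernstein _ _ ab hX).
rewrite le_eqVlt; apply/orP; left; apply/eqP; congr fl_norm.
by congr cexpsum; apply/funext => j; rewrite exprSr rmorphM /= mulrA.
Qed.

(** The order M is uniform in x and t, so the majorant is a finite combination of elements of X plus
    a constant e. *)
Lemma cexpsum_taylor (R : realType) (a b eta e : R) (r : nat) (lam : 'I_r -> R)
    (c : 'I_r -> R[i]) : 0 <= eta -> 0 < e ->
  exists M : nat, forall x t, a <= t <= b -> `|x - t| <= eta ->
  cmod (cexpsum lam c x - cexpsum lam c t) <=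
    \sum_(m < M) eta ^+ m.+1 / m.+1`!%:R *
      cmod (cexpsum lam (fun j => c j * (lam j ^+ m.+1)%:C) t) + e.
Proof.
move=> eta0 e0.
(* U bounds every |lam_j (x - t)|, and B below bounds the sum of the |c_j| e^(lam_j t) on [a, b]. *)
pose U := (\sum_j `|lam j|) * eta.
pose B := \sum_j cmod (c j) * expR (`|lam j| * (`|a| + `|b|)).
have B0 : 0 <= B by apply: sumr_ge0 => j _; rewrite mulr_ge0 ?cmod_ge0 ?expR_ge0.
have eB : 0 < e / (B + 1) by rewrite divr_gt0// ltr_wpDl.
have [M hM] := exp_partial_cvg U eB; exists M => x t /andP[at_ tb] xt.
pose D m := cexpsum lam (fun j => c j * (lam j ^+ m)%:C) t.
pose rest := \sum_j c j * (expR (lam j * t))%:C *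
  (expR (lam j * (x - t)) - exp_partial M.+1 (lam j * (x - t)))%:C.
have E : cexpsum lam c x - cexpsum lam c t =
    \sum_(m < M) ((x - t) ^+ m.+1 / m.+1`!%:R)%:C * D m.+1 + rest.
  have -> : \sum_(m < M) ((x - t) ^+ m.+1 / m.+1`!%:R)%:C * D m.+1 =
      \sum_j c j * (expR (lam j * t))%:C * (exp_partial M.+1 (lam j * (x - t)) - 1)%:C.
    rewrite /D; under eq_bigr do rewrite mulr_sumr.
    rewrite exchange_big /=; apply: eq_bigr => j _.
    rewrite /exp_partial big_ord_recl /= expr0 fact0 invr1 mulr1 addrAC subrr add0r.
    rewrite rmorph_sum /= mulr_sumr; apply: eq_bigr => m _.
    rewrite /bump /= add1n exprMn !rmorphM /=; ring.
  rewrite /rest -big_split /= /cexpsum -sumrB; apply: eq_bigr => j _.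
  set T := exp_partial _ _; rewrite -mulrDr -rmorphD /=.
  have -> : T - 1 + (expR (lam j * (x - t)) - T) = expR (lam j * (x - t)) - 1 by ring.
  have -> : lam j * x = lam j * t + lam j * (x - t) by ring.
  by rewrite expRD rmorphB rmorphM /=; ring.
rewrite E; apply: (le_trans (cmodD _ _)); apply: lerD.
  apply: (le_trans (cmod_sum _ _ _)); apply: ler_sum => m _.
  rewrite cmodM ler_wpM2r ?cmod_ge0// cmod_real normrM normrX.
  rewrite [`|_^-1|]ger0_norm ?invr_ge0// ler_wpM2r ?invr_ge0//.
  by apply: lerXn2r; rewrite ?nnegrE.
apply: (@le_trans _ _ (\sum_j cmod (c j) * expR (`|lam j| * (`|a| + `|b|)) * (e / (B + 1)))).
  apply: (le_trans (cmod_sum _ _ _)); apply: ler_sum => j _.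
  rewrite !cmodM; apply: ler_pM; rewrite ?mulr_ge0 ?cmod_ge0//.
    rewrite ler_wpM2l ?cmod_ge0// cmod_real ger0_norm ?expR_ge0// ler_expR.
    apply: (le_trans (ler_norm _)); rewrite normrM ler_wpM2l// ler_norml.
    have := ler_norm b; have := ler_norm (- a); rewrite normrN => h1 h2.
    have := normr_ge0 b; have := normr_ge0 a => h3 h4.
    by apply/andP; split; lra.
  rewrite cmod_real; apply: le_trans (expR_tail _ (_ : _ <= U)) _.
    rewrite normrM; apply: ler_pM => //; rewrite (bigD1 j) //= lerDl sumr_ge0//.
  by apply: le_trans (ler_norm _) _; apply: hM.
rewrite -mulr_suml -/B mulrCA -[leRHS]mulr1 ler_wpM2l ?(ltW e0)//.
by rewrite ler_pdivrMr ?mul1r ?lerDl// ltr_wpDl.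
Qed.

(** * Sampling *)

Lemma sample_step_ord (R : realType) (a b : R) (N : nat) (P : R -> R[i]) (x : nat -> R) :
  sample_step a b N P x = fun t => \sum_(k < N)
    (cmod (P (x k.+1)))%:C * cindic (Omega a b N k.+1) t.
Proof. by apply/funext => t; rewrite /sample_step big_add1 big_mkord. Qed.

Lemma OmegaP (R : realType) (a b : R) (N k : nat) (t : R) : (0 < N)%N -> (0 < k)%N ->
  Omega a b N k t <-> (b - a) * k.-1%:R <= (t - a) * N%:R <= (b - a) * k%:R.
Proof.
move=> N0 k0; have NR : 0 < N%:R :> R by rewrite ltr0n.
rewrite /Omega.
have -> : k%:R - 1 = k.-1%:R :> R by case: k k0 => // k _; rewrite -natr1 addrK.
rewrite /= in_itv /= -lerBrDl ler_pdivrMr// -[X in _ && X]lerBlDl.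
by rewrite ler_pdivlMr.
Qed.

Lemma Omega_sub (R : realType) (a b : R) (N k : nat) : a < b -> (k < N)%N ->
  Omega a b N k.+1 `<=` `[a, b].
Proof.
move=> ab kN t; have N0 : (0 < N)%N by apply: leq_ltn_trans kN.
have NR : 0 < N%:R :> R by rewrite ltr0n.
have ab0 : 0 < b - a by rewrite subr_gt0.
move=> /(OmegaP a b t N0 (ltn0Sn k)) /= /andP[h1 h2]; rewrite in_itv /=; apply/andP; split.
  rewrite -subr_ge0 -(pmulr_lge0 _ NR); apply: le_trans h1.
  by rewrite mulr_ge0 ?ler0n// ltW.
rewrite -(lerD2r (- a)) -(ler_pM2r NR); apply: (le_trans h2).
by rewrite ler_wpM2l ?(ltW ab0)// ler_nat.
Qed.

Lemma fl_sample_step (R : realType) (a b : R) (X : function_lattice a b) (N : nat)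
    (P : R -> R[i]) (x : nat -> R) : a < b -> fl_carrier X (sample_step a b N P x).
Proof.
move=> ab; rewrite sample_step_ord.
apply: (@fl_sum _ _ _ _ _
  (fun k t => (cmod (P (x k.+1)))%:C * cindic (Omega a b N k.+1) t)) => k kN.
apply: fl_scale; apply: fl_indic; [exact: Omega_sub|exact: measurable_itv|].
by rewrite lebesgue_measure_itv /=; case: ifP => _; rewrite ?ltry// -EFinB ltry.
Qed.

(** Adjacent closed intervals share an endpoint, where two samples are added; off the countable null
    set of grid points t lies in a single interval. *)
Lemma sample_step_ae (R : realType) (a b : R) (N : nat) (P : R -> R[i]) (x : nat -> R) :
  a < b -> (0 < N)%N ->
  ae_on a b (fun t => exists k : nat, [/\ (1 <= k <= N)%N, Omega a b N k t &
    sample_step a b N P x t = (cmod (P (x k)))%:C]).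
Proof.
move=> ab N0; have NR : 0 < N%:R :> R by rewrite ltr0n.
have ab0 : 0 < b - a by rewrite subr_gt0.
pose E := range (fun i : nat => a + (b - a) * i%:R / N%:R).
have cE : countable E by apply: sub_countable (card_image_le _ _) _; exact: countableP.
have E0 : @lebesgue_measure R E = 0%E by exact: countable_lebesgue_measure0.
have EP t i : ~ E t -> (b - a) * i%:R != (t - a) * N%:R.
  move=> nE; apply: contra_not_neq nE => h; exists i => //.
  by rewrite h mulfK ?gt_eqF// addrC subrK.
exists E; split => //.
  by apply: countable_measurable cE => ?; exact: measurable_set1.
move=> t /= nt; apply: contrapT => nE; apply: nt; rewrite in_itv /= => /andP[at_ tb].
pose y := (t - a) * N%:R / (b - a).
pose k := Num.truncn y.
have y0 : 0 <= y by rewrite divr_ge0 ?mulr_ge0 ?subr_ge0 ?ler0n// ltW.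
have /andP[k1 k2] : k%:R <= y < k.+1%:R by exact: truncn_itv.
rewrite ler_pdivlMr// mulrC in k1; rewrite ltr_pdivrMr// [_ * (b - a)]mulrC in k2.
have k1' : (b - a) * k%:R < (t - a) * N%:R by rewrite lt_neqAle EP.
have kN : (k < N)%N.
  rewrite -(ltr_nat R) -(ltr_pM2l ab0); apply: (lt_le_trans k1').
  by rewrite ler_wpM2r ?ler0n// lerD2r.
have Ok : Omega a b N k.+1 t by apply/OmegaP => //=; rewrite k1 ltW.
exists k.+1; split => //.
rewrite sample_step_ord (bigD1 (Ordinal kN)) //= cindic_in// mulr1 big1 ?addr0// => i ik.
rewrite cindic_out ?mulr0// => /(OmegaP a b t N0 (ltn0Sn i)) /= /andP[i1 i2].
move/negP: ik; apply; apply/eqP/val_inj => /=; apply/eqP; rewrite eqn_leq; apply/andP; split.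
  by rewrite -ltnS -(ltr_nat R) -(ltr_pM2l ab0); apply: le_lt_trans k2.
by rewrite -ltnS -(ltr_nat R) -(ltr_pM2l ab0); apply: lt_le_trans i2.
Qed.

Lemma cmod_dist (R : realType) (z w : R[i]) : `|cmod z - cmod w| <= cmod (z - w).
Proof.
have h (u v : R[i]) : cmod u - cmod v <= cmod (u - v).
  by rewrite lerBlDr -{1}[u](subrK v) cmodD.
rewrite ler_norml h andbT lerNl opprB; apply: (le_trans (h w z)).
by rewrite -cmodN opprB.
Qed.

Lemma expR_le_three_halves (R : realType) (th : R) : 0 <= th <= 1 / 4 -> expR th <= 3 / 2.
Proof.
move=> /andP[th0 th1]; have := expR_ge1Dx (- th); rewrite expRN => h.
have e0 := expR_gt0 th; have : (1 - th) * expR th <= 1.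
  by rewrite -ler_pdivlMr// div1r.
nra.
Qed.

Lemma sample_step_close (R : realType) (a b : R) (X : function_lattice a b) (n : nat)
    (lam : 'I_n.+1 -> R) (c : 'I_n.+1 -> R[i]) (N : nat) (x : nat -> R) :
  a < b -> rearrangement_invariant X -> (0 < N)%N ->
  4 * bernstein_const a b * (b - a) * gamma_exp lam <= N%:R ->
  (forall k : nat, (1 <= k <= N)%N -> Omega a b N k (x k)) ->
  let P := cexpsum lam c in let S := sample_step a b N P x in
  fl_norm X S <= 3 / 2 * fl_norm X P /\ fl_norm X P <= fl_norm X S + 1 / 2 * fl_norm X P.
Proof.
move=> ab hX N0 hN hx P S; have NR : 0 < N%:R :> R by rewrite ltr0n.
have ab0 : 0 < b - a by rewrite subr_gt0.
pose Kg := bernstein_const a b * gamma_exp lam.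
pose eta := (b - a) / N%:R; have eta0 : 0 <= eta by rewrite divr_ge0 ?ler0n// ltW.
have Kg0 : 0 <= Kg.
  rewrite mulr_ge0 ?(ltW (bernstein_const_gt0 ab))//.
  by rewrite addr_ge0 ?sqr_ge0// sumr_ge0.
pose th := eta * Kg.
have th0 : 0 <= th by rewrite mulr_ge0.
have th1 : th <= 1 / 4.
  rewrite /th /eta mulrAC ler_pdivrMr// /Kg; move: hN.
  have -> : 4 * bernstein_const a b * (b - a) * gamma_exp lam =
    4 * ((b - a) * (bernstein_const a b * gamma_exp lam)) by ring.
  by move: ((b - a) * (bernstein_const a b * gamma_exp lam)) => z; lra.
have P0 : 0 <= fl_norm X P by apply: fl_norm_ge0; exact: fl_cexpsum.
have cS : fl_carrier X S by exact: fl_sample_step.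
pose aP t : R[i] := (cmod (P t))%:C.
have caP : fl_carrier X aP by exact: fl_cmod.
have aPle : fl_norm X aP <= fl_norm X P.
  apply: fl_norm_le => //; first exact: fl_cexpsum.
  by move=> t _; rewrite cmod_real ger0_norm ?cmod_ge0.
have Ple : fl_norm X P <= fl_norm X aP.
  apply: fl_norm_le => //; first exact: fl_cexpsum.
  by move=> t _; rewrite cmod_real ger0_norm ?cmod_ge0.
have cbox : fl_carrier X (box a b) by exact: box_carrier.
pose kp := fl_norm X (box a b); have kp0 : 0 <= kp by exact: fl_norm_ge0.
have main e : 0 < e -> fl_norm X S <= 3 / 2 * fl_norm X P + e /\
    fl_norm X P <= fl_norm X S + 1 / 2 * fl_norm X P + e.
  (* This makes the norm of e' times the indicator of [a, b] at most e, also when kp = 0. *)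
  move=> e0; pose e' := e / (kp + 1).
  have e'0 : 0 < e' by rewrite divr_gt0// ltr_wpDl.
  have [M hM] := cexpsum_taylor a b lam c eta0 e'0.
  pose D m := cexpsum lam (fun j => c j * (lam j ^+ m)%:C).
  pose F m t := (eta ^+ m.+1 / m.+1`!%:R)%:C * (cmod (D m.+1 t))%:C : R[i].
  (* G majorizes | S - |P| | almost everywhere. By the iterated Bernstein inequality its norm is at
     most (e^th - 1) times that of P, plus e, and th <= 1/4 gives e^th - 1 <= 1/2. *)
  pose G t := \sum_(m < M) F m t + e'%:C * box a b t.
  have cF m : fl_carrier X (F m) by apply: fl_scale; exact: fl_cmod.
  have cG : fl_carrier X G by apply: fl_add; [exact: fl_sum|exact: fl_scale].
  have nG : fl_norm X G <= 1 / 2 * fl_norm X P + e.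
    apply: (le_trans (fl_normD _ _)); [exact: fl_sum|exact: fl_scale|apply: lerD].
      apply: (le_trans (fl_norm_sum _)) => //.
      apply: (@le_trans _ _ (\sum_(m < M) th ^+ m.+1 / m.+1`!%:R * fl_norm X P)).
        apply: ler_sum => m _; rewrite /F fl_normZ; last exact: fl_cmod.
        have q0 : 0 <= eta ^+ m.+1 / m.+1`!%:R :> R by rewrite divr_ge0 ?exprn_ge0 ?ler0n.
        rewrite cmod_real ger0_norm//.
        apply: (@le_trans _ _ (eta ^+ m.+1 / m.+1`!%:R * (Kg ^+ m.+1 * fl_norm X P))).
          rewrite ler_wpM2l//; apply: le_trans (fl_bernstein_iter lam c m.+1 ab hX).
          apply: fl_norm_le; [exact: fl_cmod|exact: fl_cexpsum|].
          by move=> t _; rewrite cmod_real ger0_norm ?cmod_ge0.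
        by rewrite mulrA [_ * Kg ^+ _]mulrAC -exprMn.
      rewrite -mulr_suml ler_wpM2r//.
      have := exp_partial_le M.+1 th0; rewrite /exp_partial big_ord_recl /= expr0 fact0 invr1 mulr1.
      have := expR_le_three_halves (_ : 0 <= th <= 1 / 4); rewrite th0 th1 => /(_ isT) h1 h2.
      by move: h2; rewrite /bump /=; under eq_bigr do rewrite add1n; move: h1; lra.
    rewrite fl_normZ// cmod_real gtr0_norm// -/kp /e' mulrAC ler_pdivrMr ?ltr_wpDl//.
    by rewrite ler_wpM2l ?(ltW e0)// lerDl.
  have GE t : a <= t <= b -> G t = (\sum_(m < M) eta ^+ m.+1 / m.+1`!%:R * cmod (D m.+1 t) + e')%:C.
    move=> tab; rewrite /G /box cindic_in// mulr1 rmorphD rmorph_sum /=; congr (_ + _).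
    by apply: eq_bigr => m _; rewrite /F -rmorphM.
  (* S is its own modulus, so the modulus of S + G is |S| + |G| in the lower estimate. *)
  have aeG : ae_on a b (fun t => S t = (cmod (S t))%:C /\
      `|cmod (S t) - cmod (P t)| <= cmod (G t)).
    apply: ae_lebesgueS (sample_step_ae P x ab N0) => t H tab.
    have [k [kN Ot St]] := H tab; move: tab; rewrite in_itv /= => tab.
    rewrite /S St cmod_real [`|cmod _|]ger0_norm ?cmod_ge0//; split => //.
    apply: (le_trans (cmod_dist _ _)).
    have k0 : (0 < k)%N by case/andP: kN.
    rewrite GE// cmod_real; apply: le_trans (ler_norm _); apply: hM => //.
    have /andP[w1 w2] := (OmegaP a b t N0 k0).1 Ot.
    have /andP[p1 p2] := (OmegaP a b (x k) N0 k0).1 (hx k kN).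
    rewrite /eta ler_pdivlMr// -[N%:R]gtr0_norm// -normrM ler_norml.
    have kk : k%:R = k.-1%:R + 1 :> R by rewrite natr1 prednK.
    rewrite kk mulrDr mulr1 in w2 p2.
    have -> : (x k - t) * N%:R = (x k - a) * N%:R - (t - a) * N%:R by ring.
    by apply/andP; split; lra.
  split.
    have : fl_norm X S <= fl_norm X aP + fl_norm X G.
      apply: le_trans (fl_normD caP cG); apply: fl_norm_mono => //; first exact: fl_add.
      apply: ae_lebesgueS aeG => t H tab; have [_] := H tab.
      move: tab; rewrite in_itv /= => tab; rewrite /aP GE// -(rmorphD (real_complex R)) !cmod_real.
      set g := \sum_(m < M) _ + e'; move=> h; apply: le_trans (ler_norm _).
      have g0 : 0 <= g.
        rewrite addr_ge0 ?(ltW e'0)// sumr_ge0// => m _.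
        by rewrite mulr_ge0 ?cmod_ge0// divr_ge0 ?exprn_ge0 ?ler0n.
      by move: h; rewrite [`|g|]ger0_norm// ler_norml => /andP[_]; lra.
    by move: nG aPle; lra.
  have : fl_norm X aP <= fl_norm X S + fl_norm X G.
    apply: le_trans (fl_normD cS cG); apply: fl_norm_mono => //; first exact: fl_add.
    apply: ae_lebesgueS aeG => t H tab; have [SE] := H tab.
    have {}tab : a <= t <= b by move: tab; rewrite in_itv.
    rewrite [in X in _ -> _ <= X]SE /aP GE// -(rmorphD (real_complex R)) !cmod_real.
    set g := \sum_(m < M) _ + e'; move=> h; apply: le_trans (ler_norm _).
    have g0 : 0 <= g.
      rewrite addr_ge0 ?(ltW e'0)// sumr_ge0// => m _.
      by rewrite mulr_ge0 ?cmod_ge0// divr_ge0 ?exprn_ge0 ?ler0n.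
    move: h; rewrite [`|cmod (P t)|]ger0_norm ?cmod_ge0// [`|g|]ger0_norm//.
    by rewrite ler_norml => /andP[]; lra.
  by move: nG Ple; lra.
split; apply/ler_addgt0Pr => e e0; by case: (main e e0).
Qed.

Theorem theorem6p8 (R : realType) (a b : R) (hab : a < b) :
  exists2 c2 : R, 0 < c2 &
  forall (X : function_lattice a b), rearrangement_invariant X ->
  forall eps : R, 0 < eps ->
  exists A B : R, [/\ 0 < A, 0 < B &
    forall (n : nat) (lam : 'I_n.+1 -> R),
      (forall i j : 'I_n.+1, (i < j)%N -> lam i < lam j) ->
    forall P : R -> R[i], exp_span lam P ->
    forall N : nat, (0 < N)%N ->
      (c2 / ln 2 + eps) * gamma_exp lam <= N%:R ->
    forall x : nat -> R,
      (forall k : nat, (1 <= k <= N)%N -> Omega a b N k (x k)) ->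
      A * fl_norm X (sample_step a b N P x) <= fl_norm X P /\
      fl_norm X P <= B * fl_norm X (sample_step a b N P x)].
Proof.
have K0 := bernstein_const_gt0 hab.
pose c2 := 4 * bernstein_const a b * (b - a).
have c20 : 0 < c2.
  by apply: mulr_gt0; [apply: mulr_gt0|rewrite subr_gt0].
(* These are the inverses of 3/2 and of 1 - 1/2 in [sample_step_close]. *)
exists c2 => // X hX eps eps0; exists (2 / 3), 2; split => //.
move=> n lam _ P [c PE] N N0 hN x hx.
have -> : P = cexpsum lam c by rewrite PE.
have g0 : 0 <= gamma_exp lam by rewrite addr_ge0 ?sqr_ge0// sumr_ge0.
(* Since 0 < ln 2 <= 1, c2 is at most c2 / ln 2. *)
have hN' : c2 * gamma_exp lam <= N%:R.
  apply: le_trans hN; rewrite ler_wpM2r//.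
  have l0 : 0 < ln (2 : R) by rewrite ln_gt0// ltr1n.
  have l1 : ln (2 : R) <= 1.
    rewrite -[leRHS]expRK ler_ln ?posrE ?expR_gt0//.
    by have := expR_ge1Dx (1 : R).
  apply: (@le_trans _ _ (c2 / ln 2)); last by rewrite lerDl ltW.
  by rewrite ler_pdivlMr// ler_piMr// ltW.
have [h1 h2] := sample_step_close c hab hX N0 hN' hx.
by split; move: h1 h2; lra.
Qed.
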